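(* Assume that $M_1\in\ell^2(\mu)$ and $M_2\in\ell^1(\mu)$. Then for any $f\in\mathcal{P}_*^+(X)$, $$\frac{d^2}{dt^2}\,\mathcal{H}(P_tf)=2\int_X P_tf\;\Psi_{2,\Upsilon}\big(\log(P_tf)\big)\,d\mu,\qquad t\ge 0.$$
   Context: Setting. $X$ is a finite or countably infinite set and $k:X\times X\to\mathbb{R}$ are transition rates of a continuous-time Markov chain $(Z_t)_{t\ge0}$ on $X$: $k(x,y)\ge 0$ for $x\neq y$ and $k(x,x)=-\sum_{y\neq x}k(x,y)<0$. The generator is $Lf(x)=\sum_{y\in X}k(x,y)(f(y)-f(x))$. Standing assumptions: the chain is irreducible (for all $x,y\in X$ there are $x=z_1,\dots,z_m=y$, $m\ge2$, with $k(z_i,z_{i+1})>0$); its invariant measure, unique up to positive multiples, can be normalized to a probability measure $\mu$ with density $\pi:X\to(0,\infty)$ with respect to counting measure; detailed balance $\pi(x)k(x,y)=\pi(y)k(y,x)$ holds; for every $x\in X$, $$M_1(x):=\sum_{y\neq x}k(x,y)<\infty,\qquad M_2(x):=\sum_{y\neq x}k(x,y)\sum_{z\neq y}k(y,z)<\infty;$$ and the semigroup $P_tf(x)=\mathbb{E}(f(Z_t)\mid Z_0=x)$ is Markov, i.e. $P_t1=1$ (the chain is non-explosive). Function classes. $\ell^\infty(X)$ is the space of bounded real functions on $X$; $\ell^p(\mu)$ the $p$-summable functions with respect to $\mu$. $\mathcal{P}_*^+(X)$ is the set of bounded $f:X\to(0,\infty)$ with $\inf_X f>0$ and $\sum_x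 f(x)\pi(x)=1$. Entropy: $\mathcal{H}(\rho)=\sum_{x}\rho(x)\log(\rho(x))\pi(x)$. Operators. With $\Upsilon(r)=e^r-1-r$, set $\Psi_\Upsilon(f)(x)=\sum_{y}k(x,y)\Upsilon(f(y)-f(x))$, $B_{\Upsilon'}(f,g)(x)=\sum_y k(x,y)\Upsilon'(f(y)-f(x))(g(y)-g(x))$, and for $f\in\ell^\infty(X)$ $$\Psi_{2,\Upsilon}(f)=\tfrac12\big(L\Psi_\Upsilon(f)-B_{\Upsilon'}(f,Lf)\big).$$ The derivative at $t=0$ is one-sided. *)

(* Defs.v *)
From HB Require Import structures.
From mathcomp Require Import all_boot all_order all_algebra.
From mathcomp Require Import all_classical all_reals all_analysis.

Set Implicit Arguments.
Unset Strict Implicit.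
Unset Printing Implicit Defensive.

Import Order.TTheory GRing.Theory Num.Theory.
Import numFieldNormedType.Exports.
Local Open Scope classical_set_scope.
Local Open Scope ring_scope.

(* The state space [X] is a countable type with the discrete sigma-algebra, so
   that series over [X] are integrals for the counting measure. *)
Definition discrete_countable {d} (X : measurableType d) : Prop :=
  countable [set: X] /\ forall A : set X, measurable A.

Section operators.
Context {R : realType} {d : measure_display} {X : measurableType d}.
Variable k : X -> X -> R.

Definition sumX (g : X -> R) : R := \int[counting]_y g y.

(* Extended-real valued, so that [< +oo] is a genuine condition. *)
Definition M1 (x : X) : \bar R :=
  (\int[counting]_(y in [set y | y != x]) (k x y)%:E)%E.

Definition M2 (x : X) : \bar R :=
  (\int[counting]_(y in [set y | y != x]) ((k x y)%:E * M1 y))%E.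

Definition gen (f : X -> R) (x : X) : R :=
  sumX (fun y => k x y * (f y - f x)).

Definition Upsilon (r : R) : R := expR r - 1 - r.

Definition Psi (f : X -> R) (x : X) : R :=
  sumX (fun y => k x y * Upsilon (f y - f x)).

Definition BUpsilon' (f g : X -> R) (x : X) : R :=
  sumX (fun y => k x y * derive1 Upsilon (f y - f x) * (g y - g x)).

Definition Psi2 (f : X -> R) (x : X) : R :=
  2^-1 * (gen (Psi f) x - BUpsilon' f (gen f) x).

Record transition_rates : Prop := TransitionRates {
  rates_ge0 : forall x y, x != y -> 0 <= k x y;
  rates_M1 : forall x, (M1 x < +oo)%E;
  rates_diag : forall x, (k x x)%:E = (- M1 x)%E;
  rates_diag_lt0 : forall x, k x x < 0;
  rates_M2 : forall x, (M2 x < +oo)%E }.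

Definition irreducible_rates : Prop :=
  forall x y, exists s : seq X,
    [/\ s != [::], path (fun a b => 0 < k a b) x s & last x s = y].

End operators.

Section chain.
Context {R : realType} {d d' : measure_display}.
Context {X : measurableType d} {Om : measurableType d'}.
Variables (k : X -> X -> R) (Pr : X -> probability Om R) (Z : R -> Om -> X).

Definition observed (s : seq (R * X)) : set Om :=
  [set w | forall q, q \in s -> Z q.1 w = q.2].

(* [Pr x] is the law of the process conditionally on [Z 0 = x]; only the times
   [t >= 0] matter. In [ctmc_paths], [J] is a finite list of jump times: up to
   any time horizon almost every path is a right-continuous step function with
   finitely many jumps. This is non-explosion, and it singles out the minimal
   chain with rates [k]. *)
Record is_ctmc : Prop := IsCtmc {
  ctmc_measurable : forall t : R, 0 <= t -> measurable_fun [set: Om] (Z t);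
  ctmc_start : forall x, Pr x [set w | Z 0 w = x] = 1%E;
  ctmc_markov : forall x (s : seq (R * X)) (t h : R) (y z : X),
    0 <= t -> 0 <= h -> (forall q, q \in s -> 0 <= q.1 <= t) ->
    (Pr x (observed ((t, y) :: s) `&` [set w | Z (t + h) w = z])
     = Pr x (observed ((t, y) :: s)) * Pr y [set w | Z h w = z])%E;
  ctmc_rates : forall x y,
    (fine (Pr x [set w | Z h w = y]) - (x == y)%:R) / h @[h --> 0^'+] --> k x y;
  ctmc_paths : forall x, {ae Pr x, forall w, forall T : R, exists J : seq R,
    forall r t : R, 0 <= r -> r <= t -> t <= T ->
      (forall j, j \in J -> ~~ (r < j <= t)) -> Z r w = Z t w} }.

Definition semigroup (t : R) (f : X -> R) (x : X) : R :=
  fine 'E_(Pr x)[fun w => f (Z t w)].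

Definition invariant_measure (mu : probability X R) : Prop :=
  forall (t : R) (y : X), 0 <= t ->
    (\int[mu]_x Pr x [set w | Z t w = y] = mu [set y])%E.

End chain.

Section entropy.
Context {R : realType} {d : measure_display} {X : measurableType d}.
Variable mu : probability X R.

Definition entropy (rho : X -> R) : R := \int[mu]_x (rho x * ln (rho x)).

Definition Pstar (f : X -> R) : Prop :=
  [/\ forall x, 0 < f x, has_ubound (range f), 0 < inf (range f)
    & (\int[mu]_x (f x)%:E = 1)%E].

End entropy.

(* Derivative of [F] at [t] relative to [0, +oo[: the usual derivative when
   [0 < t], the right derivative when [t = 0]. *)
Definition has_deriv_ge0 {R : realType} (F : R -> R) (t l : R) : Prop :=
  (F s - F t) / (s - t) @[s --> within [set s | 0 <= s] t^'] --> l.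

(* Main.v *)
Require Import Defs.
From HB Require Import structures.
From mathcomp Require Import all_boot all_order all_algebra.
From mathcomp Require Import all_classical all_reals all_analysis.
From mathcomp Require Import measurable_realfun ring lra.

(* Write [L] for the generator, [u = P_t f], with values in some [[a, b]], [a > 0],
   and [w = ln u].  Scheffe's lemma turns [p_h'(x, y) -> k(x, y)] at [h = 0] into
   l^1 convergence in [y], so that [u' = L u] pointwise, with
   [|L u| <= C M_1] uniformly in time.  The powers of [M_1] and the function [M_2]
   then dominate all difference quotients, whence
     [H' = int (1 + w) L u dmu],
     [H'' = int (1 + w) L (L u) + (L u)^2 / u dmu].
   On the other hand [Psi_Upsilon w = L u / u - L w] and
   [u B_Upsilon'(w, G) = L (u G) - u L G - G L u]; moving [L] around by its symmetry
   in [l^2(mu)], both [H''] and [2 int u Psi_{2,Upsilon}(w) dmu] become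
   [int (L u)^2 / u + L u L w dmu]. *)

Set Implicit Arguments.
Unset Strict Implicit.
Unset Printing Implicit Defensive.

Import Order.TTheory GRing.Theory Num.Theory.
Import numFieldNormedType.Exports.
Local Open Scope classical_set_scope.
Local Open Scope ring_scope.

(** * Integration over a discrete countable space *)

(** The obstacle is that [L] is unbounded: for bounded [u] the function [L u] is only O([M_1]), and
    [L (L u)] is known to be integrable but not to be square integrable. Two weights keep account of
    this, [w1 = 1 + M_1] and [w2 = 2 M_1 + M_2 + M_1^2]. Bounded functions and their images under
    [L] are O([w1]), [L] sends O([w1]) into O([w2]), and [w2] is [mu]-integrable because [M_1] lies
    in l^2 and [M_2] in l^1. Symmetry is therefore proved for a bounded function paired with an
    O([w1]) function, and every rearrangement of the final integrals is such a pair. In time,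
    difference quotients are dominated through the mean value theorem. This asks only for a bound on
    the derivative that is uniform in time, and such bounds follow from [a <= u <= b], which the
    semigroup preserves. *)

Section discrete_integration.
Context {R : realType} {d : measure_display} {X : measurableType d}.
Hypothesis hX : discrete_countable X.

Lemma discrete_measurable_fun d' (U : sigmaRingType d') (D : set X) (g : X -> U) :
  measurable_fun D g.
Proof. by move=> _ Y _; apply: hX.2. Qed.

(** The product sigma-algebra is generated by rectangles, so its discreteness has to be derived:
    points are rectangles, and the product is countable. *)
Lemma discrete_prod_measurable_fun d' (U : sigmaRingType d') (g : X * X -> U) :
  measurable_fun [set: X * X] g.
Proof.
move=> _ Y _; rewrite setTI; apply: countable_measurable => [[x y]|].
  rewrite (_ : [set _] = [set x] `*` [set y]); last first.
    by apply/seteqP; split=> [_ /= ->|[x' y'] [/= -> ->]].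
  by apply: measurableX; exact: hX.2.
apply: (sub_countable (subset_card_le (@subsetT _ _))).
by rewrite -setXTT; apply: countableX; exact: hX.1.
Qed.

(** The blocks are the fibres of an injection into the naturals; a number outside its image gives an
    empty block. Countable additivity along them turns integrals into series. *)
Lemma discrete_atoms : exists A : (set X)^nat,
  [/\ \bigcup_n A n = setT, trivIset setT A &
      forall n, A n = set0 \/ exists x, A n = [set x]].
Proof.
have /countable_injP[c cinj] := hX.1.
exists (fun n => [set x | c x = n]); split.
- by apply/seteqP; split=> // x _; exists (c x).
- apply/trivIsetP => i j _ _ ij; apply/seteqP; split=> // x [/= ci cj].
  by move: ij; rewrite -ci -cj eqxx.
- move=> n; have [[x cx]|nx] := pselect (exists x, c x = n).
    right; exists x; apply/seteqP; split=> [y /= cy|y /= ->//].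
    by apply: cinj; rewrite ?inE// cy cx.
  by left; apply/seteqP; split=> // x /= cx; apply: nx; exists x.
Qed.

Lemma discrete_integral_set1 (nu : {measure set X -> \bar R}) (x : X) (h : X -> \bar R) :
  (\int[nu]_(y in [set x]) h y = h x * nu [set x])%E.
Proof.
rewrite -integral_cst; last exact: hX.2.
by apply: eq_integral => y; rewrite inE => ->.
Qed.

Lemma counting_set1 (x : X) : counting [set x] = 1%:E :> \bar R.
Proof.
by rewrite /counting asboolT// fset_set1 finmap.cardfs1.
Qed.

Section discrete_pushforward.
Context {d' : measure_display} {T : measurableType d'}.
Variables (nu : {measure set T -> \bar R}) (phi : T -> X) (p : X -> R).
Hypothesis mphi : measurable_fun setT phi.
Hypothesis hp : forall x, nu (phi @^-1` [set x]) = (p x)%:E.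

Let p_ge0 x : 0 <= p x.
Proof. by rewrite -lee_fin -hp measure_ge0. Qed.

Let mpreimage (A : set X) : measurable (phi @^-1` A).
Proof. by rewrite -[_ @^-1` _]setTI; apply: mphi => //; exact: hX.2. Qed.

(** The domain is cut along the fibres of [phi], on which the integrand is constant, and the
    counting integral is cut along the same blocks. *)
Let ge0_integral_discrete_pushforward (h : X -> \bar R) : (forall x, 0 <= h x)%E ->
  (\int[nu]_w h (phi w) = \int[counting]_x ((p x)%:E * h x))%E.
Proof.
move=> h0; have [A [AT At A1]] := discrete_atoms.
rewrite (_ : [set: T] = \bigcup_n (phi @^-1` A n)); last first.
  by rewrite -preimage_bigcup AT preimage_setT.
rewrite -AT !ge0_integral_bigcup//.
- apply: eq_eseriesr => n _; have [->|[x ->]] := A1 n.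
    by rewrite preimage_set0 !integral_set0.
  rewrite discrete_integral_set1/= counting_set1 mule1 -hp muleC -integral_cst//.
  by apply: eq_integral => w; rewrite inE /= => ->.
- by move=> n; exact: hX.2.
- exact: discrete_measurable_fun.
- by move=> x _; rewrite mule_ge0// lee_fin.
- by move=> _ Y _; rewrite -preimage_bigcup; exact: mpreimage (_ `&` h @^-1` Y).
- apply/trivIsetP => i j _ _ ij; rewrite -preimage_setI.
  by move/trivIsetP : At => ->//; rewrite preimage_set0.
Qed.

(** No integrability is required: both sides are positive part minus negative part, and multiplying
    by [p >= 0] commutes with taking parts. It serves for the law of [Z t], for measures on [X]
    itself (with [phi] the identity), and for a law restricted to an event. *)
Lemma integral_discrete_pushforward (h : X -> \bar R) :
  (\int[nu]_w h (phi w) = \int[counting]_x ((p x)%:E * h x))%E.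
Proof.
have Epos : (fun w => h (phi w))^\+%E = (fun w => h^\+%E (phi w)).
  by apply/funext => w; rewrite !funeposE.
have Eneg : (fun w => h (phi w))^\-%E = (fun w => h^\-%E (phi w)).
  by apply/funext => w; rewrite !funenegE.
rewrite integralE [RHS]integralE Epos Eneg.
rewrite !ge0_integral_discrete_pushforward//; congr (_ - _)%E;
  apply: eq_integral => x _.
- by rewrite !funeposE maxe_pMr ?mule0// lee_fin.
- by rewrite !funenegE -muleN maxe_pMr ?mule0// lee_fin.
Qed.

End discrete_pushforward.

Section atoms.
Variables (nu : {measure set X -> \bar R}) (p : X -> R).
Hypothesis hp : forall x, nu [set x] = (p x)%:E.

Let p_ge0 x : 0 <= p x.
Proof. by rewrite -lee_fin -hp measure_ge0. Qed.

Lemma integral_atoms (h : X -> \bar R) :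
  (\int[nu]_x h x = \int[counting]_x ((p x)%:E * h x))%E.
Proof.
by apply: (integral_discrete_pushforward (phi := id)) => //; exact: measurable_id.
Qed.

Lemma Rintegral_atoms (h : X -> R) :
  \int[nu]_x h x = \int[counting]_x (p x * h x).
Proof. by rewrite /Rintegral integral_atoms. Qed.

Lemma integrable_atoms (h : X -> R) :
  nu.-integrable setT (EFin \o h) <->
  counting.-integrable setT (EFin \o (fun x => p x * h x)).
Proof.
have E : (\int[nu]_x `|(h x)%:E| = \int[counting]_x `|(p x * h x)%:E|)%E.
  rewrite integral_atoms; apply: eq_integral => x _ /=.
  by rewrite normrM (ger0_norm (p_ge0 x)).
split=> /integrableP[_ hi]; apply/integrableP; split;
  do ?exact: discrete_measurable_fun.
- by rewrite /= -E.
- by rewrite /= E.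
Qed.

End atoms.

Lemma counting_sigma_finite : sigma_finite setT (@counting X R).
Proof.
have [A [AT _ A1]] := discrete_atoms.
exists A => // n; split; first exact: hX.2.
have [->|[x ->]] := A1 n; first by rewrite measure0.
by rewrite counting_set1 ltry.
Qed.

(** Fubini for the counting measure, which is sigma-finite because the space is countable. Each row
    and each column is assumed integrable since [sumX] passes through [fine], which is faithful only
    on finite inner sums. *)
Lemma sumX_swap (a : X -> X -> R) :
  (\int[counting]_x \int[counting]_y `|a x y|%:E < +oo)%E ->
  (forall x, counting.-integrable setT (EFin \o a x)) ->
  (forall y, counting.-integrable setT (EFin \o (a ^~ y))) ->
  sumX (fun x => sumX (a x)) = sumX (fun y => sumX (a ^~ y)).
Proof.
move=> aoo ix iy.
pose m : {sigma_finite_measure set X -> \bar R} :=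
  HB.pack (@counting X R)
    (Measure_isSigmaFinite.Build _ _ _ (@counting X R) counting_sigma_finite).
have ia : (m \x m)%E.-integrable setT (fun z => (a z.1 z.2)%:E).
  by apply/integrable12ltyP => //; exact: discrete_prod_measurable_fun.
have := Fubini ia => /= F.
rewrite /sumX /Rintegral; congr fine.
rewrite (eq_integral (fun x => \int[counting]_y (a x y)%:E)%E); last first.
  by move=> x _; rewrite fineK//; apply: integrable_fin_num => //; exact: ix.
rewrite F; apply: eq_integral => y _; rewrite fineK//.
by apply: integrable_fin_num => //; exact: iy.
Qed.

End discrete_integration.

(** * One-sided derivatives on the half-line *)

Notation ge0_dnbhs t := (within [set s | 0 <= s] t^').

Section ge0_derivatives.
Context {R : realType}.
Implicit Types (F G : R -> R) (t s l e : R).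

Lemma ge0_dnbhsP t (P : set R) :
  (\forall s \near ge0_dnbhs t, P s) <->
  exists2 e, 0 < e & forall s, 0 <= s -> s != t -> `|s - t| < e -> P s.
Proof.
split=> [/nbhs_ballP[e /= e0 eP]|[e e0 eP]].
  by exists e => // s s0 st se; apply: eP => //=; rewrite /ball/= distrC.
apply/nbhs_ballP; exists e => //= s; rewrite /ball/= distrC => se st s0.
exact: eP.
Qed.

(** The rates are limits along [0^'+]; this moves them to the filter of [has_deriv_ge0]. *)
Lemma at_right0E : (0:R)^'+ = ge0_dnbhs (0:R).
Proof.
apply/funext => P; apply/propext; split=> /nbhs_ballP[e /= e0 eP];
  apply/nbhs_ballP; exists e => //= x xe.
  by move=> x0 x_ge0; apply: eP => //=; rewrite lt_def x0.
by move=> x_gt0; apply: eP => //=; [rewrite gt_eqF|exact: ltW].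
Qed.

(** The first-order expansion makes sense at [s = t] too, so estimates can be composed and glued
    without division. *)
Lemma has_deriv_ge0P F t l : has_deriv_ge0 F t l <->
  forall e, 0 < e -> exists2 dl, 0 < dl &
    forall s, 0 <= s -> `|s - t| < dl -> `|F s - F t - l * (s - t)| <= e * `|s - t|.
Proof.
have E s : s != t ->
    `|F s - F t - l * (s - t)| = `|l - (F s - F t) / (s - t)| * `|s - t|.
  move=> st; rewrite -normrM mulrBl divfK ?subr_eq0// -normrN; congr `|_|.
  by rewrite opprB.
split=> [/cvgrPdist_le H e e0|H].
  have /ge0_dnbhsP[dl dl0 Hd] := H _ e0; exists dl => // s s0 sdl.
  have [->|st] := eqVneq s t; first by rewrite !subrr mulr0 subrr normr0 mulr0.
  by rewrite E// ler_wpM2r//; exact: Hd.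
apply/cvgrPdist_le => e e0; have [dl dl0 Hd] := H _ e0.
apply/ge0_dnbhsP; exists dl => // s s0 st sdl; have := Hd _ s0 sdl.
by rewrite E// ler_pM2r// normr_gt0 subr_eq0.
Qed.

Lemma has_deriv_ge0_cvg F t l : has_deriv_ge0 F t l -> F s @[s --> ge0_dnbhs t] --> F t.
Proof.
move=> /has_deriv_ge0P/(_ _ ltr01)[dl dl0 H].
apply/cvgrPdist_le => e e0; apply/ge0_dnbhsP.
have c0 : 0 < `|l| + 1 by rewrite ltr_wpDl.
exists (Num.min dl (e / (`|l| + 1))); first by rewrite lt_min dl0 divr_gt0.
move=> s s0 _; rewrite lt_min => /andP[sdl se].
rewrite distrC (_ : F s - F t = F s - F t - l * (s - t) + l * (s - t)); last by ring.
rewrite (le_trans (ler_normD _ _))// (le_trans (lerD (H _ s0 sdl) (lexx _)))//.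
rewrite normrM -mulrDl addrC -ler_pdivlMl// mulrC.
by rewrite -[leRHS]mulrC ltW// mulrC.
Qed.

Lemma has_deriv_ge0_cst c t : has_deriv_ge0 (fun=> c) t 0.
Proof.
apply/has_deriv_ge0P => e e0; exists 1 => // s _ _.
by rewrite subrr mul0r subrr normr0 mulr_ge0// ltW.
Qed.

Lemma has_deriv_ge0D F G t l l' : has_deriv_ge0 F t l -> has_deriv_ge0 G t l' ->
  has_deriv_ge0 (fun s => F s + G s) t (l + l').
Proof.
move=> HF HG; rewrite /has_deriv_ge0.
rewrite (_ : (fun _ => _) = (fun s => (F s - F t) / (s - t) + (G s - G t) / (s - t))).
  exact: cvgD.
by apply/funext => s; rewrite -mulrDl; congr (_ / _); ring.
Qed.

Lemma has_deriv_ge0M F G t l l' : has_deriv_ge0 F t l -> has_deriv_ge0 G t l' ->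
  has_deriv_ge0 (fun s => F s * G s) t (l * G t + F t * l').
Proof.
move=> HF HG; rewrite /has_deriv_ge0.
rewrite (_ : (fun _ => _) = (fun s => (F s - F t) / (s - t) * G t +
    F s * ((G s - G t) / (s - t)))).
  apply: cvgD; first by apply: cvgM => //; exact: cvg_cst.
  by apply: cvgM => //; exact: has_deriv_ge0_cvg HF.
by apply/funext => s; rewrite mulrAC mulrA -mulrDl; congr (_ / _); ring.
Qed.

Lemma is_derive1P F t l : is_derive t 1 F l <->
  forall e, 0 < e -> exists2 dl, 0 < dl &
    forall s, `|s - t| < dl -> `|F s - F t - l * (s - t)| <= e * `|s - t|.
Proof.
have E r : r != 0 ->
    `|F (r + t) - F t - l * r| = `|l - r^-1 * (F (r + t) - F t)| * `|r|.
  move=> r0; rewrite -normrM mulrBl (mulrC r^-1) divfK// -normrN; congr `|_|.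
  by rewrite opprB.
split=> [[dF Fl]|H].
  have /cvgrPdist_le H : r^-1 *: ((F \o shift t) (r *: 1) - F t) @[r --> 0^'] --> l.
    by rewrite -Fl; exact: dF.
  move=> e /H /nbhs_ballP[dl /= dl0 Hd]; exists dl => // s sdl.
  have [->|st] := eqVneq s t; first by rewrite !subrr mulr0 subrr normr0 mulr0.
  have st0 : s - t != 0 by rewrite subr_eq0.
  have := Hd (s - t); rewrite /ball/= sub0r normrN => /(_ sdl st0).
  by rewrite [_ *: 1]mulr1 => /(ler_wpM2r (normr_ge0 (s - t))); rewrite -E// subrK.
have cl : r^-1 *: ((F \o shift t) (r *: 1) - F t) @[r --> 0^'] --> l.
  apply/cvgrPdist_le => e e0; have [dl dl0 Hd] := H _ e0.
  apply/nbhs_ballP; exists dl => //= r; rewrite /ball/= sub0r normrN => rdl r0.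
  rewrite [_ *: 1]mulr1; have := Hd (r + t); rewrite addrK E// => /(_ rdl).
  by rewrite ler_pM2r// normr_gt0.
by split; [apply/cvg_ex; exists l|exact/cvg_lim].
Qed.

Lemma has_deriv_ge0_comp (h : R -> R) F t l a : is_derive (F t) 1 h a ->
  has_deriv_ge0 F t l -> has_deriv_ge0 (h \o F) t (a * l).
Proof.
move=> /is_derive1P Hh HF; apply/has_deriv_ge0P => e e0.
have l0 : 0 < `|l| + 1 by rewrite ltr_wpDl.
have a0 : 0 < `|a| + 1 by rewrite ltr_wpDl.
(* The remainder is that of [h] at [F t] plus [a] times that of [F], and each gets half of [e]. Near
   [t] the increment of [F] is at most [(|l| + 1) * |s - t|]; the [+ 1] also avoids dividing by zero
   when [l] or [a] vanishes. *)
have [dh dh0 {}Hh] := Hh (e / 2 / (`|l| + 1)) ltac:(by rewrite !divr_gt0).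
have /cvgrPdist_lt/(_ _ dh0)/ge0_dnbhsP[d1 d10 H1] := has_deriv_ge0_cvg HF.
move/has_deriv_ge0P : HF => HF.
have [d2 d20 H2] := HF _ ltr01.
have [d3 d30 H3] := HF (e / 2 / (`|a| + 1)) ltac:(by rewrite !divr_gt0).
exists (Num.min d1 (Num.min d2 d3)); first by rewrite !lt_min d10 d20 d30.
move=> s s0; rewrite !lt_min => /and3P[sd1 sd2 sd3] /=.
have [->|st] := eqVneq s t; first by rewrite !subrr mulr0 subrr normr0 mulr0.
have {}H1 : `|F s - F t| < dh by rewrite distrC; exact: H1.
have {}H2 : `|F s - F t| <= (`|l| + 1) * `|s - t|.
  rewrite (_ : F s - F t = F s - F t - l * (s - t) + l * (s - t)); last by ring.
  rewrite (le_trans (ler_normD _ _))// (le_trans (lerD (H2 _ s0 sd2) (lexx _)))//.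
  by rewrite normrM -mulrDl addrC.
rewrite (_ : _ - _ = (h (F s) - h (F t) - a * (F s - F t)) +
   a * (F s - F t - l * (s - t))); last by ring.
rewrite (le_trans (ler_normD _ _))// normrM.
have := lerD (Hh _ H1) (ler_wpM2l (normr_ge0 a) (H3 _ s0 sd3)).
move=> /le_trans; apply.
have e1 : e / 2 / (`|l| + 1) * `|F s - F t| <= e / 2 * `|s - t|.
  rewrite -mulrA; apply: ler_wpM2l; first by rewrite ltW// divr_gt0.
  by rewrite mulrC ler_pdivrMr// mulrC.
have e2 : `|a| * (e / 2 / (`|a| + 1) * `|s - t|) <= e / 2 * `|s - t|.
  rewrite mulrA; apply: ler_wpM2r => //; rewrite mulrCA; apply: ler_piMr.
    by rewrite ltW// divr_gt0.
  by rewrite ler_pdivrMr// mul1r lerDl.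
by rewrite (le_trans (lerD e1 e2))// -mulrDl -splitr.
Qed.

Lemma has_deriv_ge0_ln F t l : 0 < F t -> has_deriv_ge0 F t l ->
  has_deriv_ge0 (fun s => ln (F s)) t (l / F t).
Proof.
move=> Ft0 HF; rewrite mulrC; apply: (@has_deriv_ge0_comp (@ln R)) HF.
exact: is_derive1_ln.
Qed.

(** Mean value theorem: at positive times the derivative is two-sided, and at the left end, possibly
    0, only continuity is needed. This is the source of the dominating functions below. *)
Lemma has_deriv_ge0_lipschitz F F' (B : R) :
  (forall t, 0 <= t -> has_deriv_ge0 F t (F' t)) ->
  (forall t, 0 <= t -> `|F' t| <= B) ->
  forall s t, 0 <= s -> 0 <= t -> `|F s - F t| <= B * `|s - t|.
Proof.
move=> HF HB.
suff H t s : 0 <= t -> t < s -> `|F s - F t| <= B * `|s - t|.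
  move=> s t s0 t0; have [st|ts|->] := ltgtP s t; last by rewrite !subrr normr0 mulr0.
    by rewrite distrC (distrC s); exact: H.
  exact: H.
move=> t0 ts.
have dF (r : R) : 0 < r -> is_derive r 1 F (F' r).
  move=> r0; apply/is_derive1P => e e0.
  have /has_deriv_ge0P/(_ _ e0)[dl dl0 Hd] := HF r (ltW r0).
  exists (Num.min dl r) => [|y]; first by rewrite lt_min dl0.
  rewrite lt_min => /andP[ydl yr]; apply: Hd => //.
  by move: yr; rewrite ltr_distl => /andP[]; rewrite subrr => /ltW.
have [||c] := @MVT _ F F' t s ts.
- by move=> r; rewrite in_itv/= => /andP[tr _]; apply: dF; exact: le_lt_trans tr.
- have cF (r : R) : 0 < r -> {for r, continuous F}.
    by move=> /dF[/derivable1_diffP/differentiable_continuous].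
  apply/(continuous_within_itvP _ ts); split.
  + by move=> r; rewrite in_itv/= => /andP[tr _]; apply: cF; exact: le_lt_trans tr.
  + apply/cvgrPdist_lt => e e0.
    have /cvgrPdist_lt/(_ _ e0)/ge0_dnbhsP[dl dl0 Hd] := has_deriv_ge0_cvg (HF _ t0).
    apply/nbhs_ballP; exists dl => //= r; rewrite /ball/= distrC => rdl tr.
    by apply: Hd => //; [rewrite ltW// (le_lt_trans t0)|rewrite gt_eqF].
  + by apply: cvg_at_left_filter; apply: cF; exact: le_lt_trans ts.
rewrite in_itv/= => /andP[tc _] ->; rewrite normrM ler_wpM2r//.
by apply: HB; rewrite ltW// (le_lt_trans t0).
Qed.

End ge0_derivatives.

(** * Dominated convergence and differentiation under the integral *)

Section ge0_dominated.
Context {R : realType} {d : measure_display} {T : measurableType d}.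
Variable m : {measure set T -> \bar R}.

Lemma integrable_scale (f : T -> R) (c : R) : m.-integrable setT (EFin \o f) ->
  m.-integrable setT (EFin \o (fun x => c * f x)).
Proof. by move=> fi; exact: (integrableZl measurableT c fi). Qed.

Lemma integrable_add (f g : T -> R) : m.-integrable setT (EFin \o f) ->
  m.-integrable setT (EFin \o g) -> m.-integrable setT (EFin \o (fun x => f x + g x)).
Proof. by move=> fi gi; exact: (integrableD measurableT fi gi). Qed.

Lemma integrable_sub (f g : T -> R) : m.-integrable setT (EFin \o f) ->
  m.-integrable setT (EFin \o g) -> m.-integrable setT (EFin \o (fun x => f x - g x)).
Proof. by move=> fi gi; exact: (integrableB measurableT fi gi). Qed.

(** Dominated convergence speaks of sequences. If the limit failed, violating points could be picked
    within [1 / (n + 1)] of [t]; they are picked in [P], so that a domination valid only near [t]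
    holds along the whole sequence. *)
Lemma cvg_ge0_dnbhs_seq (f : R -> R) (t l : R) (P : R -> Prop) :
  (\forall s \near ge0_dnbhs t, P s) ->
  (forall w : R^nat, (forall n, [/\ 0 <= w n, w n != t & P (w n)]) ->
     w @ \oo --> t -> f (w n) @[n --> \oo] --> l) ->
  f s @[s --> ge0_dnbhs t] --> l.
Proof.
move=> /ge0_dnbhsP[d0 d00 HP] H; apply/cvgrPdist_lt => e e0.
apply/ge0_dnbhsP; apply: contrapT => Hn.
have {Hn}Hn n : exists s,
    [/\ 0 <= s, s != t, P s, `|s - t| < n.+1%:R^-1 & e <= `|l - f s|].
  apply: contrapT => Hs; apply: Hn; exists (Num.min d0 n.+1%:R^-1).
    by rewrite lt_min d00/= invr_gt0.
  move=> s s0 st; rewrite lt_min => /andP[sd sn]; rewrite ltNge; apply/negP => es.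
  by apply: Hs; exists s; split=> //; exact: HP.
have [w Hw] := choice Hn.
have /cvgrPdist_lt/(_ _ e0)[N _ HN] : f (w n) @[n --> \oo] --> l.
  apply: H => [n|]; first by case: (Hw n).
  apply/cvgrPdist_lt => e1 e10.
  have := @cvg_harmonic R; move=> /cvgrPdist_lt/(_ _ e10)[N _ HN].
  exists N => // n /HN /=; rewrite sub0r normrN ger0_norm ?invr_ge0//.
  move=> /(lt_trans _); apply.
  by rewrite distrC; case: (Hw n).
have /= := HN N (leqnn N); rewrite ltNge => /negP; apply.
by case: (Hw N).
Qed.

Lemma cvg_ge0_dnbhs_Rintegral (F : R -> T -> R) (l G : T -> R) (t : R) :
  (forall s, 0 <= s -> measurable_fun setT (F s)) -> measurable_fun setT l ->
  (forall x, F s x @[s --> ge0_dnbhs t] --> l x) ->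
  m.-integrable setT (EFin \o G) ->
  (\forall s \near ge0_dnbhs t, forall x, `|F s x| <= G x) ->
  \int[m]_x F s x @[s --> ge0_dnbhs t] --> \int[m]_x l x.
Proof.
move=> mF ml Fl iG FG; apply: (cvg_ge0_dnbhs_seq FG) => w Hw wt.
have Fw x : F (w n) x @[n --> \oo] --> l x.
  apply/cvgrPdist_lt => e e0.
  have /cvgrPdist_lt/(_ _ e0)/ge0_dnbhsP[dl dl0 Hd] := Fl x.
  have /cvgrPdist_lt/(_ _ dl0)[N _ HN] := wt.
  by exists N => // n /HN/= ?; case: (Hw n) => *; apply: Hd => //; rewrite distrC.
have lG x : `|l x| <= G x.
  have : `|F (w n) x| @[n --> \oo] --> `|l x| by exact: cvg_norm.
  move=> Fn; rewrite -(cvg_lim (@Rhausdorff R) Fn); apply: limr_le.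
    by apply/cvg_ex; exists `|l x|.
  by apply: nearW => n; case: (Hw n).
have il : m.-integrable setT (EFin \o l).
  apply: le_integrable iG => //; first exact/measurable_EFinP.
  by move=> x _ /=; rewrite lee_fin (le_trans (lG x))// ler_norm.
apply: fine_cvg; rewrite /Rintegral fineK; last exact: integrable_fin_num.
apply: (@dominated_cvg _ _ _ m _ _ (fun n x => (F (w n) x)%:E) _ (EFin \o G)) => //.
- by move=> n; apply/measurable_EFinP/mF; case: (Hw n).
- by move=> x _; apply: cvg_EFin; [exact: nearW|exact: Fw].
- by move=> n x _; rewrite lee_fin; case: (Hw n).
Qed.

(** A Lipschitz bound in time with constant [G x] dominates all difference quotients at once;
    integrability of [F'] follows in the limit. *)
Lemma has_deriv_ge0_Rintegral (F : R -> T -> R) (F' G : T -> R) (t : R) :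
  0 <= t ->
  (forall s, 0 <= s -> m.-integrable setT (EFin \o F s)) ->
  measurable_fun setT F' ->
  (forall x, has_deriv_ge0 (F^~ x) t (F' x)) ->
  m.-integrable setT (EFin \o G) ->
  (forall s x, 0 <= s -> `|F s x - F t x| <= G x * `|s - t|) ->
  has_deriv_ge0 (fun s => \int[m]_x F s x) t (\int[m]_x F' x).
Proof.
move=> t0 iF mF' dF iG lip; rewrite /has_deriv_ge0.
have iB s : 0 <= s -> m.-integrable setT (EFin \o (fun x => F s x - F t x)).
  by move=> s0; apply: integrable_sub; exact: iF.
have : (\int[m]_x ((F s x - F t x) / (s - t))) @[s --> ge0_dnbhs t] --> \int[m]_x F' x.
  apply: (@cvg_ge0_dnbhs_Rintegral _ _ G) => //.
  - move=> s s0; apply: measurable_funM; last exact: measurable_cst.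
    by apply/measurable_EFinP; exact: (measurable_int _ (iB s s0)).
  - apply/ge0_dnbhsP; exists 1 => // s s0 st _ x.
    by rewrite normrM normfV ler_pdivrMr ?normr_gt0 ?subr_eq0//; exact: lip.
apply: cvg_trans; apply: near_eq_cvg; apply/ge0_dnbhsP; exists 1 => // s s0 st _.
rewrite RintegralZr//; last exact: iB.
by rewrite RintegralB//; exact: iF.
Qed.

End ge0_dominated.

(** * The generator and its symmetry *)

Section rates.
Context {R : realType} {d : measure_display} {X : measurableType d}.
Hypothesis hX : discrete_countable X.
Variable k : X -> X -> R.
Hypothesis hk : transition_rates k.

Definition m1 (x : X) : R := fine (M1 k x).
Definition m2 (x : X) : R := fine (M2 k x).

Lemma M1_ge0 x : (0 <= M1 k x)%E.
Proof.
by apply: integral_ge0 => y /= yx; rewrite lee_fin (rates_ge0 hk)// eq_sym.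
Qed.

Lemma M2_ge0 x : (0 <= M2 k x)%E.
Proof.
apply: integral_ge0 => y /= yx; rewrite mule_ge0 ?M1_ge0//.
by rewrite lee_fin (rates_ge0 hk)// eq_sym.
Qed.

Lemma M1E x : M1 k x = (m1 x)%:E.
Proof. by rewrite fineK// ge0_fin_numE ?M1_ge0// (rates_M1 hk). Qed.

Lemma M2E x : M2 k x = (m2 x)%:E.
Proof. by rewrite fineK// ge0_fin_numE ?M2_ge0// (rates_M2 hk). Qed.

Lemma m1_ge0 x : 0 <= m1 x.
Proof. by rewrite fine_ge0// M1_ge0. Qed.

Lemma m2_ge0 x : 0 <= m2 x.
Proof. by rewrite fine_ge0// M2_ge0. Qed.

Lemma rate_diagE x : k x x = - m1 x.
Proof. by have := rates_diag hk x; rewrite M1E => -[]. Qed.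

Lemma integral_abs_rates (W : X -> R) x : (forall y, 0 <= W y) ->
  (\int[counting]_y (`|k x y| * W y)%:E =
   (m1 x * W x)%:E + \int[counting]_(y in [set y | y != x]) (k x y * W y)%:E)%E.
Proof.
move=> W0.
rewrite (_ : setT = [set x] `|` [set y | y != x]); last first.
  apply/seteqP; split=> // y _; have [->|yx] := eqVneq y x; by [left|right].
rewrite ge0_integral_setU//=; first last.
- by apply/disj_setPS => y [/= -> /eqP].
- by move=> y _; rewrite lee_fin mulr_ge0.
- exact: discrete_measurable_fun.
- exact: hX.2.
- exact: hX.2.
rewrite discrete_integral_set1//= counting_set1 mule1 rate_diagE normrN.
rewrite ger0_norm ?m1_ge0//.
congr (_ + _)%E; apply: eq_integral => y; rewrite inE /= => yx.
by rewrite ger0_norm// (rates_ge0 hk)// eq_sym.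
Qed.

Lemma integral_abs_rates1 x : (\int[counting]_y (`|k x y| * 1)%:E = (2 * m1 x)%:E)%E.
Proof.
rewrite (@integral_abs_rates (fun=> 1))//.
under eq_integral do rewrite mulr1.
by rewrite -/(M1 k x) M1E -EFinD; congr (_%:E); ring.
Qed.

Definition w1 x := 1 + m1 x.
(** This is the sum over [y] of [|k x y| * w1 y]: the diagonal gives [m1 + m1 ^+ 2], the other
    states give [m1 + m2]. *)
Definition w2 x := 2 * m1 x + m2 x + m1 x ^+ 2.

Lemma w1_ge0 x : 0 <= w1 x.
Proof. by rewrite addr_ge0// m1_ge0. Qed.

Lemma integral_abs_rates_w1 x : (\int[counting]_y (`|k x y| * w1 y)%:E = (w2 x)%:E)%E.
Proof.
rewrite integral_abs_rates; last exact: w1_ge0.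
under eq_integral do rewrite mulrDr mulr1 EFinD.
rewrite ge0_integralD//=; first last.
- exact: discrete_measurable_fun.
- move=> y /= yx; rewrite lee_fin mulr_ge0 ?m1_ge0// (rates_ge0 hk)// eq_sym//.
- exact: discrete_measurable_fun.
- by move=> y /= yx; rewrite lee_fin (rates_ge0 hk)// eq_sym.
- exact: hX.2.
rewrite -/(M1 k x) M1E (_ : (\int[_]_(_ in _) _)%E = M2 k x).
  by rewrite M2E -!EFinD /w1 /w2; congr (_%:E); ring.
by apply: eq_integral => y _; rewrite M1E EFinM.
Qed.

(** Meant for two weights: [W = 1], for which [I] is [2 * m1], and [W = w1], for which [I] is
    [w2]. *)
Lemma rates_sum_bound (W I F : X -> R) (C : R) x : (forall y, 0 <= W y) -> 
  (\int[counting]_y (`|k x y| * W y)%:E = (I x)%:E)%E ->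
  (forall y, `|F y| <= C * W y) ->
  counting.-integrable setT (EFin \o (fun y => k x y * F y)) /\
  `|sumX (fun y => k x y * F y)| <= C * I x.
Proof.
move=> W0 IE FC.
have iW : counting.-integrable setT (EFin \o (fun y => `|k x y| * W y)).
  apply/integrableP; split; first exact: discrete_measurable_fun.
  rewrite (_ : (\int[_]_x _)%E = (I x)%:E) ?ltry// -IE; apply: eq_integral => y _ /=.
  by rewrite ger0_norm// mulr_ge0.
have iCW : counting.-integrable setT (EFin \o (fun y => C * (`|k x y| * W y))).
  exact: integrable_scale.
have le y : `|k x y * F y| <= C * (`|k x y| * W y).
  by rewrite normrM mulrCA; apply: ler_wpM2l.
have iF : counting.-integrable setT (EFin \o (fun y => k x y * F y)).
  apply: le_integrable iCW => //; first exact: discrete_measurable_fun.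
  by move=> y _ /=; rewrite lee_fin (le_trans (le y))// ler_norm.
split=> //; apply: (le_trans (le_normr_Rintegral _ iF)) => //.
have -> : C * I x = \int[counting]_y (C * (`|k x y| * W y)).
  by rewrite RintegralZl// /Rintegral IE.
apply: le_Rintegral => //; exact: integrable_norm.
Qed.

Lemma w2_ge0 x : 0 <= w2 x.
Proof. by rewrite !addr_ge0 ?mulr_ge0 ?m2_ge0 ?m1_ge0// sqr_ge0. Qed.

Lemma integrable_rates (F : X -> R) (C : R) x : (forall y, `|F y| <= C * w1 y) ->
  counting.-integrable setT (EFin \o (fun y => k x y * F y)).
Proof.
by move=> FC; have [] := rates_sum_bound w1_ge0 (integral_abs_rates_w1 x) FC.
Qed.

Lemma bounded_w1 (F : X -> R) (C : R) : (forall y, `|F y| <= C) ->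
  forall y, `|F y| <= C * w1 y.
Proof.
move=> FC y; have C0 : 0 <= C by rewrite (le_trans _ (FC y)).
by rewrite (le_trans (FC y))// ler_peMr// lerDl m1_ge0.
Qed.

Lemma m1_bounded_w1 (F : X -> R) (C : R) : 0 <= C -> (forall y, `|F y| <= C * m1 y) ->
  forall y, `|F y| <= C * w1 y.
Proof.
move=> C0 FC y; rewrite (le_trans (FC y))//.
by rewrite ler_wpM2l// lerDr.
Qed.

Lemma sum_rates x : sumX (k x) = 0.
Proof.
have i1 : counting.-integrable setT (EFin \o k x).
  have := @integrable_rates (fun=> 1) 1 x; under eq_fun do rewrite mulr1.
  by apply; apply: bounded_w1 => y; rewrite normr1.
rewrite /sumX /Rintegral.
rewrite (_ : setT = [set x] `|` [set y | y != x]) in i1 *; last first.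
  apply/seteqP; split=> // y _; have [->|yx] := eqVneq y x; by [left|right].
rewrite integral_setU_EFin//=; first last.
- by apply/disj_setPS => y [/= -> /eqP].
- exact: discrete_measurable_fun.
- exact: hX.2.
- exact: hX.2.
rewrite discrete_integral_set1//= counting_set1 mule1 -/(M1 k x) M1E rate_diagE.
by rewrite -EFinD/= addNr.
Qed.

Lemma integrable_gen (F : X -> R) (C : R) x : (forall y, `|F y| <= C * w1 y) ->
  counting.-integrable setT (EFin \o (fun y => k x y * (F y - F x))).
Proof.
move=> FC; under eq_fun do rewrite mulrBr.
apply: integrable_sub; first exact: integrable_rates FC.
by apply: (@integrable_rates (fun=> F x) `|F x|); apply: bounded_w1 => y.
Qed.

(** The rows of [k] sum to 0, so the term in [F x] drops out; the O([w1]) bound makes both sums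
    converge separately. *)
Lemma genE (F : X -> R) (C : R) x : (forall y, `|F y| <= C * w1 y) ->
  gen k F x = sumX (fun y => k x y * F y).
Proof.
move=> FC; rewrite /gen /sumX; under eq_Rintegral do rewrite mulrBr.
have i1 : counting.-integrable setT (EFin \o k x).
  have := @integrable_rates (fun=> 1) 1 x; under eq_fun do rewrite mulr1.
  by apply; apply: bounded_w1 => y; rewrite normr1.
rewrite RintegralB//; first last.
- by apply: (@integrable_rates (fun=> F x) `|F x|); apply: bounded_w1 => y.
- exact: integrable_rates FC.
by rewrite RintegralZr// -/(sumX (k x)) sum_rates mul0r subr0.
Qed.

Lemma gen_bound (F : X -> R) (C : R) x : (forall y, `|F y| <= C) ->
  `|gen k F x| <= 2 * C * m1 x.
Proof.
move=> FC; rewrite (genE x (bounded_w1 FC)) mulrAC mulrC.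
have F1 y : `|F y| <= C * 1 by rewrite mulr1.
by have [] := @rates_sum_bound (fun=> 1) (fun x => 2 * m1 x) F C x (fun=> ler01)
  (integral_abs_rates1 x) F1.
Qed.

Lemma gen_bound_w1 (F : X -> R) (C : R) x : (forall y, `|F y| <= C * w1 y) ->
  `|gen k F x| <= C * w2 x.
Proof.
move=> FC; rewrite (genE x FC).
by have [] := rates_sum_bound w1_ge0 (integral_abs_rates_w1 x) FC.
Qed.

Section detailed_balance.
Variables (mu : probability X R) (dens : X -> R).
Hypothesis hpi : forall x, mu [set x] = (dens x)%:E.
Hypothesis hdb : forall x y, dens x * k x y = dens y * k y x.
Hypothesis iw2 : mu.-integrable setT (EFin \o w2).

Lemma dominated_w2 (F : X -> R) (C : R) : (forall x, `|F x| <= C * w2 x) ->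
  mu.-integrable setT (EFin \o F).
Proof.
move=> FC; have iC : mu.-integrable setT (EFin \o (fun x => C * w2 x)).
  exact: integrable_scale.
apply: le_integrable iC => //; first exact: discrete_measurable_fun.
by move=> y _ /=; rewrite lee_fin (le_trans (FC y))// ler_norm.
Qed.

(** By detailed balance the kernel [a] reads the same from both ends, so exchanging the sums
    exchanges [F] and [G]. One function may grow like [w1] provided the other is bounded: absolute
    convergence then reduces to integrability of [D * (C * w2)]. *)
Lemma gen_symmetric (F G : X -> R) (C D : R) :
  (forall x, `|F x| <= C * w1 x) -> (forall x, `|G x| <= D) ->
  \int[mu]_x (G x * gen k F x) = \int[mu]_x (F x * gen k G x).
Proof.
move=> FC GD; have GD1 := bounded_w1 GD.
pose a x y := dens x * G x * (k x y * F y).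
have aE x y : a x y = dens y * F y * (k y x * G x).
  rewrite /a (_ : _ * _ = (dens x * k x y) * (G x * F y)); last by ring.
  by rewrite hdb; ring.
rewrite !(Rintegral_atoms hX hpi).
transitivity (sumX (fun x => sumX (a x))).
  apply: eq_Rintegral => x _; rewrite (genE _ FC) mulrA /a.
  by rewrite -RintegralZl//; exact: integrable_rates FC.
have ia x : counting.-integrable setT (EFin \o a x).
  by apply: integrable_scale; exact: integrable_rates FC.
rewrite sumX_swap//.
- apply: eq_Rintegral => y _; rewrite (genE _ GD1) mulrA.
  rewrite -RintegralZl//; last exact: integrable_rates GD1.
  by apply: eq_Rintegral => x _; rewrite aE.
- apply: (@le_lt_trans _ _ (\int[mu]_x (D * (C * w2 x))%:E)%E); last first.
    have iDCw := integrable_scale D (integrable_scale C iw2).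
    rewrite (eq_integral (fun x => `|(D * (C * w2 x))%:E|)%E).
      by have /integrableP[] := iDCw.
    move=> x _ /=; rewrite ger0_norm// mulr_ge0//.
      exact: le_trans (GD x).
    exact: le_trans (gen_bound_w1 x FC).
  rewrite (integral_atoms hX hpi); apply: ge0_le_integral => //.
  + by move=> x _; apply: integral_ge0 => y _; rewrite lee_fin.
  + exact: discrete_measurable_fun.
  + exact: discrete_measurable_fun.
  + move=> x _.
    have dx0 : 0 <= dens x by rewrite -lee_fin -hpi measure_ge0.
    have Dx : `|dens x * G x| <= dens x * D by rewrite normrM ger0_norm// ler_wpM2l.
    apply: (@le_trans _ _ (\int[counting]_y (dens x * D * (C * (`|k x y| * w1 y)))%:E)%E).
      apply: ge0_le_integral => //.
      * exact: discrete_measurable_fun.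
      * exact: discrete_measurable_fun.
      * move=> y _; rewrite lee_fin /a normrM ler_pM// normrM mulrCA.
        by apply: ler_wpM2l.
    have iw : counting.-integrable setT (EFin \o (fun y => `|k x y| * w1 y)).
      apply/integrableP; split; first exact: discrete_measurable_fun.
      rewrite (_ : (\int[_]_x _)%E = (w2 x)%:E) ?ltry// -integral_abs_rates_w1.
      by apply: eq_integral => y _ /=; rewrite ger0_norm// mulr_ge0// w1_ge0.
    under eq_integral do rewrite mulrA EFinM.
    rewrite integralZl// integral_abs_rates_w1 -!EFinM lee_fin.
    by rewrite !mulrA.
- move=> y; under [X in _ \o X]eq_fun do rewrite aE.
  by apply: integrable_scale; exact: integrable_rates GD1.
Qed.

End detailed_balance.
End rates.

(** * The second-order identity at a fixed time *)

Section static_identity.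
Context {R : realType} {d : measure_display} {X : measurableType d}.
Hypothesis hX : discrete_countable X.
Variable k : X -> X -> R.
Hypothesis hk : transition_rates k.
Variables (mu : probability X R) (dens : X -> R).
Hypothesis hpi : forall x, mu [set x] = (dens x)%:E.
Hypothesis hdb : forall x y, dens x * k x y = dens y * k y x.
Hypothesis iw2 : mu.-integrable setT (EFin \o w2 k).

Lemma Rintegral_half_sum (f1 f2 f3 f4 : X -> R) :
  mu.-integrable setT (EFin \o f1) -> mu.-integrable setT (EFin \o f2) ->
  mu.-integrable setT (EFin \o f3) -> mu.-integrable setT (EFin \o f4) ->
  2 * \int[mu]_x (2^-1 * (f1 x - f2 x + f3 x + f4 x)) =
  \int[mu]_x f1 x - \int[mu]_x f2 x + \int[mu]_x f3 x + \int[mu]_x f4 x.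
Proof.
move=> i1 i2 i3 i4; have i12 := integrable_sub i1 i2.
have i123 := integrable_add i12 i3.
rewrite RintegralZl//; last exact: integrable_add.
rewrite mulrA mulfV// mul1r (RintegralD measurableT i123 i4).
by rewrite (RintegralD measurableT i12 i3) (RintegralB measurableT i1 i2).
Qed.

Lemma ln_bound (a b r : R) : 0 < a -> a <= r <= b -> `|ln r| <= `|ln a| + `|ln b|.
Proof.
move=> a0 /andP[ar rb]; have r0 := lt_le_trans a0 ar; have b0 := lt_le_trans r0 rb.
have l1 : ln a <= ln r by rewrite ler_ln.
have l2 : ln r <= ln b by rewrite ler_ln.
have := ler_norm (ln b); have := ler_norm (- ln a); rewrite normrN.
have := normr_ge0 (ln a); have := normr_ge0 (ln b).
by move=> *; rewrite ler_norml; apply/andP; split; lra.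
Qed.

Variables (u : X -> R) (a b : R).
Hypotheses (a_gt0 : 0 < a) (hu : forall x, a <= u x <= b).

Let w x := ln (u x).

Let u_gt0 x : 0 < u x.
Proof. by have /andP[+ _] := hu x; exact: lt_le_trans. Qed.

Let u_bound x : `|u x| <= b.
Proof. by rewrite gtr0_norm//; have /andP[] := hu x. Qed.

Let b_ge0 : 0 <= b.
Proof. exact: le_trans (u_bound point). Qed.

Let ln_u_bound x : `|w x| <= `|ln a| + `|ln b|.
Proof. exact: ln_bound. Qed.

Let u1 := bounded_w1 hk u_bound.
Let w1b := bounded_w1 hk ln_u_bound.

Lemma derive1_Upsilon (r : R) : derive1 Upsilon r = expR r - 1.
Proof.
rewrite derive1E /Upsilon.
have : is_derive r 1 (fun r : R => expR r - 1 - r) (expR r - 0 - 1).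
  by apply: is_deriveB.
by move=> H; rewrite derive_val subr0.
Qed.

Let expRw x y : expR (ln (u y) - ln (u x)) = u y / u x.
Proof. by rewrite expRB !lnK ?posrE. Qed.

(** As [expR (w y - w x) = u y / u x], the exponential part of [Upsilon] becomes linear in [u]. *)
Lemma Psi_lnE x : Psi k w x = gen k u x / u x - gen k w x.
Proof.
rewrite /Psi /gen.
have i1 := integrable_gen hX hk x u1.
have i2 := integrable_gen hX hk x w1b.
rewrite /sumX -RintegralZr// -RintegralB//; last first.
  by under eq_fun do rewrite mulrC; exact: integrable_scale.
apply: eq_Rintegral => y _; rewrite /Upsilon expRw /w.
by field; rewrite gt_eqF.
Qed.

(** [u x] times the derivative of [Upsilon] at [w y - w x] is [u y - u x]. The left side is thus the
    sum of [k x y * (u y - u x) * (G y - G x)], twice the carré du champ of [u] and [G], and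
    expanding the product gives the right side. *)
Lemma BUpsilon'_lnE (G : X -> R) C x : (forall y, `|G y| <= C * w1 k y) ->
  u x * BUpsilon' k w G x =
  gen k (fun y => u y * G y) x - u x * gen k G x - G x * gen k u x.
Proof.
move=> GC.
have uG y : `|u y * G y| <= b * C * w1 k y.
  by rewrite normrM -mulrA ler_pM.
have i1 := integrable_gen hX hk x u1.
have i2 := integrable_gen hX hk x GC.
have i3 := integrable_gen hX hk x uG.
have i4 := integrable_scale (u x) i2.
have i5 := integrable_scale (G x) i1.
have iB : counting.-integrable setT (EFin \o
    (fun y => k x y * derive1 Upsilon (w y - w x) * (G y - G x))).
  have := integrable_scale (u x)^-1 (integrable_sub (integrable_sub i3 i4) i5).
  apply: eq_integrable => // y _ /=; congr (_%:E).
  by rewrite derive1_Upsilon expRw; field; rewrite gt_eqF.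
rewrite /BUpsilon' /gen /sumX -!RintegralZl// -!RintegralB//; last first.
  exact: integrable_sub.
apply: eq_Rintegral => y _; rewrite derive1_Upsilon expRw.
by field; rewrite gt_eqF.
Qed.

Let g x := u x * Psi2 k w x.
Let D := `|ln a| + `|ln b|.

Let gen_u_w1 x : `|gen k u x| <= 2 * b * w1 k x.
Proof.
by apply: m1_bounded_w1; [rewrite mulr_ge0|move=> y; exact: gen_bound].
Qed.

Let D_ge0 : 0 <= D. Proof. by rewrite addr_ge0. Qed.

Let gen_w_w1 x : `|gen k w x| <= 2 * D * w1 k x.
Proof.
by apply: m1_bounded_w1; [rewrite mulr_ge0|move=> y; exact: gen_bound].
Qed.

(** By [Psi_lnE] this is [Psi k w], in the form that shows it to be O([w1]); the quotient by [a] in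
    [CH] comes from [u >= a]. *)
Let H x := gen k u x / u x - gen k w x.
Let CH := 2 * b / a + 2 * D.

Let H_w1 x : `|H x| <= CH * w1 k x.
Proof.
rewrite (le_trans (ler_normB _ _))// /CH mulrDl lerD//.
rewrite normrM mulrAC ler_pM// normfV lef_pV2 ?posrE ?normr_gt0 ?gt_eqF//.
by rewrite gtr0_norm//; case/andP: (hu x).
Qed.

(** The factor [u] absorbs the nonlinearity of [BUpsilon'], taken at [G = gen k w]. Only products of
    a function with the generator of another one remain, to which symmetry applies. *)
Let gE x : g x = 2^-1 * (u x * gen k H x - gen k (fun y => u y * gen k w y) x
   + u x * gen k (gen k w) x + gen k w x * gen k u x).
Proof.
rewrite /g /Psi2 (_ : Psi k w = H); last by apply/funext => y; exact: Psi_lnE.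
rewrite mulrCA mulrBr (BUpsilon'_lnE x gen_w_w1); congr (_ * _); ring.
Qed.

Let mw1 x : m1 k x * w1 k x <= w2 k x.
Proof.
rewrite /w1 /w2 mulrDr mulr1 -expr2 lerD2r.
by have := m1_ge0 hk x; have := m2_ge0 hk x; lra.
Qed.

(** Two kinds of product are integrable: bounded times O([w2]) here, O([w1]) times O([m1]) in
    [dom_w1]. *)
Let dom_bounded (F G : X -> R) C E : (forall x, `|F x| <= C) ->
  (forall x, `|G x| <= E * w1 k x) ->
  mu.-integrable setT (EFin \o (fun x => F x * gen k G x)).
Proof.
move=> FC GE; apply: (dominated_w2 hX iw2 (C := C * E)) => // x.
by rewrite normrM -mulrA ler_pM//; exact: gen_bound_w1.
Qed.

Let dom_w1 (F G : X -> R) C E : (forall x, `|F x| <= C * w1 k x) ->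
  (forall x, `|G x| <= E) ->
  mu.-integrable setT (EFin \o (fun x => F x * gen k G x)).
Proof.
move=> FC GE; apply: (dominated_w2 hX iw2 (C := C * (2 * E))) => // x.
have E0 : 0 <= E by exact: le_trans (GE x).
have CE0 : 0 <= C * (2 * E).
  have w0 : 0 < w1 k x by rewrite ltr_pwDl// m1_ge0.
  rewrite mulr_ge0 ?mulr_ge0// -(pmulr_lge0 _ w0).
  exact: le_trans (FC x).
rewrite (le_trans _ (ler_wpM2l CE0 (mw1 x)))//.
rewrite normrM (le_trans (ler_pM _ _ (FC x) (gen_bound hX hk x GE)))//.
by rewrite le_eqVlt; apply/orP; left; apply/eqP; ring.
Qed.

Let uGw x : `|u x * gen k w x| <= b * (2 * D) * w1 k x.
Proof. by rewrite normrM -mulrA ler_pM. Qed.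

Let one_bound (x : X) : `|1 : R| <= 1. Proof. by rewrite normr1. Qed.

Let i1 := dom_bounded u_bound H_w1.
Let i2 : mu.-integrable setT (EFin \o gen k (fun y => u y * gen k w y)).
Proof.
have := dom_bounded (F := fun=> 1) one_bound uGw.
by under eq_fun do rewrite mul1r.
Qed.
Let i3 := dom_bounded u_bound gen_w_w1.
Let i4 := dom_w1 gen_w_w1 u_bound.

Lemma integrable_Psi2 : mu.-integrable setT (EFin \o g).
Proof.
rewrite (funext gE : g = _).
by apply: integrable_scale; do 2 apply: integrable_add => //; exact: integrable_sub.
Qed.

Lemma integral_Psi2 :
  \int[mu]_x (gen k (gen k u) x * (1 + w x) + gen k u x * (gen k u x / u x)) =
  2 * \int[mu]_x g x.
Proof.
have w1_bound x : `|1 + w x| <= 1 + D.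
  by rewrite (le_trans (ler_normD _ _))// normr1 lerD2l.
have gen1w : gen k (fun x => 1 + w x) = gen k w.
  by apply/funext => x; apply: eq_Rintegral => y _; congr (_ * _); ring.
have gen1 : gen k (fun=> 1) = fun=> 0.
  apply/funext => x; rewrite /gen /sumX; under eq_Rintegral do rewrite subrr mulr0.
  by rewrite Rintegral_cst// mul0r.
have j1 := dom_bounded w1_bound gen_u_w1.
have Hu_w1 x : `|gen k u x / u x| <= 2 * b / a * w1 k x.
  rewrite normrM mulrAC ler_pM// normfV lef_pV2 ?posrE ?normr_gt0 ?gt_eqF//.
  by rewrite gtr0_norm//; case/andP: (hu x).
have j2 := dom_w1 Hu_w1 u_bound.
(* Let A be the integral of [(gen k u)^2 / u] and B that of [gen k u * gen k w]. [S1] turns the term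
   with [1 + w] into B; [S2] gives A - B for [u * gen k H]; [S3], a pairing with 1, makes the
   integral of [gen k (u * gen k w)] vanish; [S4] gives B for [u * gen k (gen k w)]. Both sides
   equal A + B. *)
have S1 := gen_symmetric hX hk hpi hdb iw2 gen_u_w1 w1_bound.
have S2 := gen_symmetric hX hk hpi hdb iw2 H_w1 u_bound.
have S3 := gen_symmetric hX hk hpi hdb iw2 uGw one_bound.
have S4 := gen_symmetric hX hk hpi hdb iw2 gen_w_w1 u_bound.
have Hu : \int[mu]_x (u x * gen k H x) =
    \int[mu]_x (gen k u x / u x * gen k u x) - \int[mu]_x (gen k w x * gen k u x).
  rewrite S2 -(RintegralB measurableT j2 i4).
  by apply: eq_Rintegral => x _; rewrite mulrBl.
have uGw0 : \int[mu]_x gen k (fun y => u y * gen k w y) x = 0.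
  rewrite -[RHS](mul0r (fine (mu setT))) -(Rintegral_cst _ measurableT).
  transitivity (\int[mu]_x (1 * gen k (fun y => u y * gen k w y) x)).
    by apply: eq_Rintegral => x _; rewrite mul1r.
  by rewrite S3 gen1; apply: eq_Rintegral => x _; rewrite mulr0.
have -> : \int[mu]_x g x = \int[mu]_x (2^-1 * (u x * gen k H x -
    gen k (fun y => u y * gen k w y) x + u x * gen k (gen k w) x +
    gen k w x * gen k u x)).
  by apply: eq_Rintegral => x _; rewrite gE.
rewrite (Rintegral_half_sum i1 i2 i3 i4) Hu uGw0 S4.
transitivity (\int[mu]_x ((1 + w x) * gen k (gen k u) x + gen k u x / u x * gen k u x)).
  by apply: eq_Rintegral => x _; congr (_ + _); rewrite mulrC.
rewrite (RintegralD measurableT j1 j2) S1 gen1w.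
rewrite (_ : \int[mu]_x (gen k u x * gen k w x) =
  \int[mu]_x (gen k w x * gen k u x)); last first.
  by apply: eq_Rintegral => x _; rewrite mulrC.
ring.
Qed.

End static_identity.

(** * Transition probabilities and the semigroup *)

Section transition_probabilities.
Context {R : realType} {d d' : measure_display}.
Context {X : measurableType d} {Om : measurableType d'}.
Hypothesis hX : discrete_countable X.
Variables (k : X -> X -> R) (Pr : X -> probability Om R) (Z : R -> Om -> X).
Hypothesis hk : transition_rates k.
Hypothesis hZ : is_ctmc k Pr Z.

Definition trans (t : R) (x y : X) : R := fine (Pr x [set w | Z t w = y]).

Lemma measurable_observed t y : 0 <= t -> measurable [set w | Z t w = y].
Proof.
by move=> t0; have := ctmc_measurable hZ t0 measurableT (hX.2 [set y]); rewrite setTI.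
Qed.

Lemma transE t x y : 0 <= t -> Pr x [set w | Z t w = y] = (trans t x y)%:E.
Proof.
by move=> t0; rewrite fineK// fin_num_measure//; exact: measurable_observed.
Qed.

Lemma trans_ge0 t x y : 0 <= trans t x y.
Proof. by rewrite fine_ge0. Qed.

Lemma trans_le1 t x y : 0 <= t -> trans t x y <= 1.
Proof.
move=> t0; rewrite -lee_fin -transE//; apply: probability_le1.
exact: measurable_observed.
Qed.

Lemma integral_trans (h : X -> \bar R) t x : 0 <= t ->
  (\int[Pr x]_w h (Z t w) = \int[counting]_y ((trans t x y)%:E * h y))%E.
Proof.
move=> t0; apply: (integral_discrete_pushforward hX) => [|y].
  exact: (ctmc_measurable hZ).
exact: transE.
Qed.

Lemma semigroupE (F : X -> R) t x : 0 <= t ->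
  semigroup Pr Z t F x = sumX (fun y => trans t x y * F y).
Proof.
by move=> t0; rewrite /semigroup unlock (integral_trans (EFin \o F)).
Qed.

Lemma integral_trans1 t x : 0 <= t -> (\int[counting]_y (trans t x y)%:E = 1)%E.
Proof.
move=> t0; have := integral_trans (cst 1%E) x t0.
rewrite integral_cst//= probability_setT mule1 => ->.
by apply: eq_integral => y _; rewrite mule1.
Qed.

Lemma sum_trans t x : 0 <= t -> sumX (trans t x) = 1.
Proof. by move=> t0; rewrite /sumX /Rintegral integral_trans1. Qed.

Lemma integrable_trans t x : 0 <= t ->
  counting.-integrable setT (EFin \o trans t x).
Proof.
move=> t0; apply/integrableP; split; first exact: discrete_measurable_fun.
rewrite (_ : (\int[_]_x _)%E = 1%E) ?ltry// -(integral_trans1 x t0).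
by apply: eq_integral => y _ /=; rewrite ger0_norm// trans_ge0.
Qed.

Lemma discrete_integrableMr (h F : X -> R) (C : R) :
  counting.-integrable setT (EFin \o h) -> (forall y, `|F y| <= C) ->
  counting.-integrable setT (EFin \o (fun y => h y * F y)).
Proof.
move=> ih FC; have iC := integrable_scale C (integrable_norm ih).
apply: (le_integrable _ _ _ iC) => //.
  exact: discrete_measurable_fun.
move=> y _ /=; rewrite lee_fin normrM mulrC (le_trans _ (ler_norm _))//.
by apply: ler_wpM2r.
Qed.

Lemma sum_norm_bound (h F : X -> R) (C : R) :
  counting.-integrable setT (EFin \o h) -> (forall y, `|F y| <= C) ->
  `|sumX (fun y => h y * F y)| <= C * sumX (fun y => `|h y|).
Proof.
move=> ih FC; have ihF := discrete_integrableMr ih FC.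
apply: (le_trans (le_normr_Rintegral _ ihF)) => //.
have ihn : counting.-integrable setT (EFin \o (fun y => `|h y|)).
  exact: integrable_norm.
rewrite /sumX -RintegralZl//; apply: le_Rintegral => //.
- exact: (integrable_norm ihF).
- exact: integrable_scale.
- by move=> y _; rewrite normrM mulrC ler_wpM2r.
Qed.

(** The law [Pr x] restricted to the event [B] is pushed forward by [Z h]. The Markov property with
    empty past gives its atoms, and its total mass is the left side. *)
Lemma chapman_kolmogorov h t x z : 0 <= h -> 0 <= t ->
  trans (h + t) x z = sumX (fun y => trans h x y * trans t y z).
Proof.
move=> h0 t0.
pose B := [set w | Z (h + t) w = z].
have mB : measurable B by exact/measurable_observed/addr_ge0.
have := integral_discrete_pushforward hX (nu := mrestr (Pr x) mB) (phi := Z h)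
  (p := fun y => trans h x y * trans t y z) (ctmc_measurable hZ h0) _ (cst 1%E).
rewrite integral_cst// mul1e => H.
rewrite /trans -/B (_ : Pr x B = mrestr (Pr x) mB setT); last by rewrite /mrestr setTI.
rewrite H; last first.
  move=> y; rewrite EFinM -!transE//.
  have := ctmc_markov hZ x (s := [::]) y z h0 t0.
  have -> : observed Z [:: (h, y)] = [set w | Z h w = y].
    apply/seteqP; split=> [w /(_ (h, y))|w /= Zw q]; first by rewrite inE eqxx; apply.
    by rewrite inE => /eqP ->.
  by move=> <-.
by congr fine; apply: eq_integral => y _; rewrite mule1.
Qed.

Section semigroup_bounds.
Variables (f : X -> R) (a b : R).
Hypotheses (hf : forall x, a <= f x <= b).

Let f_bound x : `|f x| <= `|a| + `|b|.
Proof.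
have /andP[af fb] := hf x; have := ler_norm b; have := ler_norm (- a).
rewrite normrN; have := normr_ge0 a; have := normr_ge0 b.
by move=> *; rewrite ler_norml; apply/andP; split; lra.
Qed.

Lemma semigroup_bounds t x : 0 <= t -> a <= semigroup Pr Z t f x <= b.
Proof.
move=> t0; rewrite semigroupE//.
have it := integrable_trans x t0; have itf := discrete_integrableMr it f_bound.
have E c : c = sumX (fun y => c * trans t x y).
  by rewrite /sumX RintegralZl// -/(sumX _) sum_trans// mulr1.
apply/andP; split; [rewrite [leLHS](E a)|rewrite [leRHS](E b)];
  apply: le_Rintegral => //; do ?exact: integrable_scale;
  move=> y _; have /andP[af fb] := hf y.
- by rewrite mulrC ler_wpM2l// trans_ge0.
- by rewrite [leRHS]mulrC ler_wpM2l// trans_ge0.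
Qed.

(** Chapman-Kolmogorov and an exchange of sums, dominated by [|a| + |b|] times probabilities of
    total mass 1. The step [h] is made first, as the backward equation requires. *)
Lemma semigroupD h t x : 0 <= h -> 0 <= t ->
  semigroup Pr Z (h + t) f x = sumX (fun y => trans h x y * semigroup Pr Z t f y).
Proof.
move=> h0 t0; rewrite semigroupE ?addr_ge0//.
pose c y z := trans h x y * (trans t y z * f z).
have it y := discrete_integrableMr (integrable_trans y t0) f_bound.
have tz z y : `|trans t y z * f z| <= `|a| + `|b|.
  rewrite normrM ger0_norm ?trans_ge0// -[leRHS]mul1r ler_pM ?trans_ge0//.
  exact: trans_le1.
transitivity (sumX (fun z => sumX (c ^~ z))).
  apply: eq_Rintegral => z _; rewrite chapman_kolmogorov//.
  rewrite /sumX -RintegralZr//.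
    by apply: eq_Rintegral => y _; rewrite /c mulrA.
  apply: (discrete_integrableMr (C := 1)); first exact: integrable_trans.
  by move=> y; rewrite ger0_norm ?trans_ge0 ?trans_le1.
rewrite -sumX_swap//.
- apply: eq_Rintegral => y _; rewrite semigroupE// /c /sumX.
  by rewrite RintegralZl.
- have ib := integrable_scale (`|a| + `|b|) (integrable_trans x h0).
  apply: (@le_lt_trans _ _
    (\int[counting]_y `|((`|a| + `|b|) * trans h x y)%:E|)%E); last first.
    by have /integrableP[] := ib.
  apply: ge0_le_integral => //.
  + by move=> y _; apply: integral_ge0.
  + exact: discrete_measurable_fun.
  + exact: discrete_measurable_fun.
  + move=> y _.
    apply: (@le_trans _ _
      (\int[counting]_z (trans h x y * ((`|a| + `|b|) * trans t y z))%:E)%E).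
      apply: ge0_le_integral => //.
      * exact: discrete_measurable_fun.
      * exact: discrete_measurable_fun.
      * move=> z _; rewrite lee_fin /c normrM ger0_norm ?trans_ge0//.
        rewrite ler_wpM2l ?trans_ge0// normrM ger0_norm ?trans_ge0// mulrC.
        by rewrite ler_wpM2r// trans_ge0.
    under eq_integral do rewrite mulrA EFinM.
    rewrite integralZl//; last exact: integrable_trans.
    by rewrite integral_trans1// mule1 lee_fin mulrC ler_norm.
- by move=> y; apply: integrable_scale.
- move=> z; apply: (discrete_integrableMr (C := `|a| + `|b|)) => //.
  exact: integrable_trans.
Qed.

End semigroup_bounds.

Definition rate_err (x : X) (h : R) (y : X) : R :=
  (trans h x y - (x == y)%:R) / h - k x y.

Lemma dirac_set1 (x y : X) : \d_x [set y] = ((x == y)%:R : R)%:E.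
Proof.
rewrite diracE (_ : (x \in [set y]) = (x == y))//.
by apply/idP/eqP => [|->]; rewrite inE.
Qed.

Lemma integral_delta (x : X) (F : X -> R) : sumX (fun y => (x == y)%:R * F y) = F x.
Proof.
have hd := dirac_set1 x.
rewrite /sumX -(Rintegral_atoms hX hd) /Rintegral integral_dirac//; last first.
  exact: discrete_measurable_fun.
by rewrite diracE in_setT mul1e.
Qed.

Lemma integrable_delta (x : X) :
  counting.-integrable setT (EFin \o (fun y : X => (x == y)%:R : R)).
Proof.
have hd := dirac_set1 x.
have /(integrable_atoms hX hd) :
    (dirac x).-integrable setT (EFin \o (fun _ : X => 1 : R)).
  exact: finite_measure_integrable_cst.
by under [X in _ \o X]eq_fun do rewrite mulr1.
Qed.

Lemma integrable_rates1 x : counting.-integrable setT (EFin \o k x).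
Proof.
have := @integrable_rates _ _ _ hX _ hk (fun=> 1) 1 x.
under [X in _ \o X]eq_fun do rewrite mulr1.
by apply; apply: (bounded_w1 hk) => y; rewrite normr1.
Qed.

Lemma integrable_rate_err x h : 0 <= h ->
  counting.-integrable setT (EFin \o rate_err x h).
Proof.
move=> h0; apply: integrable_sub; last exact: integrable_rates1.
under [X in _ \o X]eq_fun do rewrite mulrC.
apply: integrable_scale; apply: integrable_sub; first exact: integrable_trans.
exact: integrable_delta.
Qed.

(** The error of the difference quotient at 0 is a pairing of [F] with [rate_err], so the l^1 norm
    of [rate_err] controls all [F] under a common bound at once. *)
Lemma sum_rate_err x h (F : X -> R) C : 0 < h -> (forall y, `|F y| <= C) ->
  sumX (fun y => rate_err x h y * F y) =
  (sumX (fun y => trans h x y * F y) - F x) / h - gen k F x.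
Proof.
move=> h0 FC; rewrite (genE hX hk x (bounded_w1 hk FC)) -[F x](integral_delta x).
have j1 := discrete_integrableMr (integrable_trans x (ltW h0)) FC.
have j2 := discrete_integrableMr (integrable_delta x) FC.
have j3 := discrete_integrableMr (integrable_rates1 x) FC.
have j4 := integrable_sub j1 j2.
rewrite /sumX -RintegralB// -RintegralZr// -RintegralB//; last first.
  by under [X in _ \o X]eq_fun do rewrite mulrC; exact: integrable_scale.
by apply: eq_Rintegral => y _; rewrite /rate_err; ring.
Qed.

End transition_probabilities.

(** * The backward equation *)

Section backward_equation.
Context {R : realType} {d d' : measure_display}.
Context {X : measurableType d} {Om : measurableType d'}.
Hypothesis hX : discrete_countable X.
Variables (k : X -> X -> R) (Pr : X -> probability Om R) (Z : R -> Om -> X).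
Hypothesis hk : transition_rates k.
Hypothesis hZ : is_ctmc k Pr Z.

(** The case [F = 1]: transition probabilities sum to 1 and [gen] kills constants. *)
Lemma sum_rate_err0 x h : 0 < h -> sumX (rate_err k Pr Z x h) = 0.
Proof.
move=> h0; have one_bound (y : X) : `|1 : R| <= 1 by rewrite normr1.
have := sum_rate_err hX hk hZ x h0 one_bound.
rewrite (_ : sumX (fun y => _ * 1) = sumX (rate_err k Pr Z x h)); last first.
  by apply: eq_Rintegral => y _; rewrite mulr1.
move=> ->; rewrite (_ : sumX _ = sumX (trans Pr Z h x)); last first.
  by apply: eq_Rintegral => y _; rewrite mulr1.
rewrite (sum_trans hX hZ x (ltW h0)) subrr mul0r sub0r /gen.
rewrite (_ : sumX _ = 0) ?oppr0//.
transitivity (sumX (fun _ : X => 0 : R)).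
  by apply: eq_Rintegral => y _; rewrite subrr mulr0.
by rewrite /sumX Rintegral_cst// mul0r.
Qed.

(* As the errors sum to 0, their l^1 norm is twice the sum of the negative
   parts, which are dominated by the rates (Scheffe). *)
Lemma cvg_sum_rate_err x :
  sumX (fun y => `|rate_err k Pr Z x h y|) @[h --> ge0_dnbhs (0 : R)] --> 0.
Proof.
have err0 y : rate_err k Pr Z x h y @[h --> ge0_dnbhs (0 : R)] --> 0.
  have := @ctmc_rates _ _ _ _ _ _ _ _ hZ x y; rewrite at_right0E -(subrr (k x y)) => H.
  by apply: cvgB => //; exact: cvg_cst.
have neg0 y : Num.max 0 (- rate_err k Pr Z x h y) @[h --> ge0_dnbhs (0 : R)] --> 0.
  have := err0 y; move=> /cvgrPdist_lt H; apply/cvgrPdist_lt => e e0.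
  have /ge0_dnbhsP[dl dl0 Hd] := H _ e0; apply/ge0_dnbhsP; exists dl => // h h0 hn hd.
  have := Hd h h0 hn hd; rewrite !sub0r !normrN ltr_norml => /andP[l1 l2].
  by rewrite ger0_norm ?le_max ?lexx// gt_max e0/= ltrNl.
(* Off the diagonal, [trans >= 0] bounds the negative part of the error by [k x y]. At [y = x] the
   quotient may be negative, but the error exceeds -1 for small [h], whence the added
   [(x == y)%:R]. *)
pose G y := `|k x y| + (x == y)%:R.
have iG : counting.-integrable setT (EFin \o G).
  apply: integrable_add; last exact: integrable_delta.
  exact/integrable_norm/integrable_rates1.
have lim0 : \int[counting]_y Num.max 0 (- rate_err k Pr Z x h y)
    @[h --> ge0_dnbhs (0 : R)] --> Rintegral (@counting X R) setT (cst 0).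
  apply: (cvg_ge0_dnbhs_Rintegral (G := G)) => //.
  - by move=> h _; exact: discrete_measurable_fun.
  - have /cvgrPdist_lt/(_ _ ltr01)/ge0_dnbhsP[dl dl0 Hd] := err0 x.
    apply/ge0_dnbhsP; exists dl => // h h0 hn hd y.
    rewrite ger0_norm ?le_max ?lexx// ge_max /G addr_ge0//=.
    have [<-|xy] := eqVneq x y.
      have := Hd h h0 hn hd; rewrite sub0r normrN ltr_norml => /andP[l1 l2].
      by rewrite lerNl (le_trans _ (ltW l1))// lerN2 lerDr.
    rewrite addr0 /rate_err (negbTE xy) subr0 opprB.
    apply: (@le_trans _ _ (k x y)); last exact: (ler_norm (k x y)).
    by rewrite gerBl divr_ge0// trans_ge0.
rewrite Rintegral_cst// mul0r in lim0.
have lim2 : 2 * \int[counting]_y Num.max 0 (- rate_err k Pr Z x h y)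
    @[h --> ge0_dnbhs (0 : R)] --> (0 : R).
  by rewrite -[X in _ --> X](mulr0 2); apply: cvgM => //; exact: cvg_cst.
move: lim2; apply: cvg_trans.
apply: near_eq_cvg; apply/ge0_dnbhsP; exists 1 => // h h0 hn _.
have hp : 0 < h by rewrite lt_def hn.
have ie := integrable_rate_err hX hk hZ x (ltW hp).
have ine : counting.-integrable setT
    (EFin \o (fun y => Num.max 0 (- rate_err k Pr Z x h y))).
  apply: (le_integrable _ _ _ ie) => //; first exact: discrete_measurable_fun.
  move=> y _ /=; rewrite lee_fin ger0_norm ?le_max ?lexx// ge_max normr_ge0/=.
  by rewrite -normrN ler_norm.
have i2 := integrable_scale 2 ine.
transitivity (sumX (rate_err k Pr Z x h) +
    2 * \int[counting]_y Num.max 0 (- rate_err k Pr Z x h y)).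
  by rewrite (sum_rate_err0 x hp) add0r.
rewrite /sumX -(RintegralZl 2 measurableT ine) -(RintegralD measurableT ie i2).
apply/esym/eq_Rintegral => y _.
case: (leP 0 (- rate_err k Pr Z x h y)) => e0.
  by rewrite -normrN ger0_norm//; ring.
by rewrite mulr0 addr0 ger0_norm// ltW// -oppr_lt0.
Qed.

Variables (f : X -> R) (a b : R).
Hypotheses (hf : forall x, a <= f x <= b).
Let u t := semigroup Pr Z t f.
Let C := `|a| + `|b|.

Lemma semigroup_norm_bound t x : 0 <= t -> `|u t x| <= C.
Proof.
move=> t0; have /andP[af fb] := semigroup_bounds hX hZ hf x t0.
have := ler_norm b; have := ler_norm (- a).
rewrite normrN; have := normr_ge0 a; have := normr_ge0 b.
by move=> *; rewrite ler_norml /C /u; apply/andP; split; lra.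
Qed.

Let C_ge0 : 0 <= C. Proof. by rewrite addr_ge0. Qed.

(** [dl] does not depend on [t], because only the bound [C], common to all times, multiplies the l^1
    norm of the error. Derivatives from the left rest on this uniformity, since there the starting
    time moves. *)
Lemma semigroup_increment x e : 0 < e -> exists2 dl, 0 < dl &
  forall t h, 0 <= t -> 0 <= h -> h < dl ->
    `|u (t + h) x - u t x - h * gen k (u t) x| <= e * h.
Proof.
move=> e0.
have c0 : 0 < C + 1 by rewrite ltr_wpDl.
have := cvg_sum_rate_err x => /cvgrPdist_lt/(_ _ (divr_gt0 e0 c0))/ge0_dnbhsP[dl dl0 Hd].
exists dl => // t h t0; rewrite le_eqVlt => /predU1P[<- _|h0 hdl].
  by rewrite addr0 mul0r subrr subr0 normr0 mulr0.
have uC y := semigroup_norm_bound y t0.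
have E : u (t + h) x - u t x - h * gen k (u t) x =
    sumX (fun y => rate_err k Pr Z x h y * u t y) * h.
  have -> : u (t + h) x = sumX (fun y => trans Pr Z h x y * u t y).
    by rewrite addrC /u (semigroupD hX hZ hf)// ltW.
  rewrite (sum_rate_err hX hk hZ x h0 uC).
  by field; rewrite gt_eqF.
rewrite E normrM (gtr0_norm h0) ler_wpM2r ?(ltW h0)//.
have ie := integrable_rate_err hX hk hZ x (ltW h0).
apply: (le_trans (sum_norm_bound hX ie uC)).
have := Hd h (ltW h0); rewrite gt_eqF// subr0 (gtr0_norm h0) => /(_ isT hdl).
rewrite sub0r normrN => /(le_lt_trans (ler_norm _)) /ltW Hs.
rewrite (le_trans (ler_wpM2l C_ge0 Hs))// mulrCA ler_piMr ?(ltW e0)//.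
by rewrite ler_pdivrMr// mul1r lerDl.
Qed.

Lemma semigroup_cvg (t : R) x : 0 <= t -> u s x @[s --> ge0_dnbhs t] --> u t x.
Proof.
move=> t0; have [dl dl0 Hd] := semigroup_increment x ltr01.
have B_ge0 : 0 <= 2 * C * m1 k x by rewrite !mulr_ge0// m1_ge0.
have inc r h : 0 <= r -> 0 <= h -> h < dl ->
    `|u (r + h) x - u r x| <= (1 + 2 * C * m1 k x) * h.
  move=> r0 h0 hdl.
  rewrite (_ : u (r + h) x - u r x =
    (u (r + h) x - u r x - h * gen k (u r) x) + h * gen k (u r) x); last by ring.
  rewrite (le_trans (ler_normD _ _))// mulrDl; apply: lerD; first exact: Hd.
  rewrite normrM (ger0_norm h0) mulrC ler_wpM2r//.
  by apply: (gen_bound hX hk) => y; exact: semigroup_norm_bound.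
have c0 : 0 < 1 + 2 * C * m1 k x by rewrite ltr_pwDl.
apply/cvgrPdist_lt => e e0; apply/ge0_dnbhsP.
exists (Num.min dl (e / (1 + 2 * C * m1 k x))); first by rewrite lt_min dl0 divr_gt0.
move=> s s0 _; rewrite lt_min ltr_pdivlMr// mulrC => /andP[sdl se].
have [st|/ltW ts] := leP s t.
  have ts0 : 0 <= t - s by rewrite subr_ge0.
  have Et : `|s - t| = t - s by rewrite distrC ger0_norm.
  rewrite Et in sdl se; have := inc s (t - s) s0 ts0 sdl.
  by rewrite (addrC s) subrK => /le_lt_trans; apply.
have ts0 : 0 <= s - t by rewrite subr_ge0.
have Es : `|s - t| = s - t by rewrite ger0_norm.
rewrite Es in sdl se; have := inc t (s - t) t0 ts0 sdl.
by rewrite (addrC t) subrK (distrC (u t x)) => /le_lt_trans; apply.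
Qed.

Lemma gen_semigroup_cvg (t : R) x : 0 <= t ->
  gen k (u s) x @[s --> ge0_dnbhs t] --> gen k (u t) x.
Proof.
move=> t0; have ut y := semigroup_norm_bound y t0.
rewrite (genE hX hk x (bounded_w1 hk ut)).
have : sumX (fun y => k x y * u s y) @[s --> ge0_dnbhs t] -->
    sumX (fun y => k x y * u t y).
  apply: (cvg_ge0_dnbhs_Rintegral (G := fun y => C * `|k x y|)).
  - by move=> h _; exact: discrete_measurable_fun.
  - exact: discrete_measurable_fun.
  - by move=> y; apply: cvgM; [exact: cvg_cst|exact: semigroup_cvg].
  - exact/integrable_scale/integrable_norm/integrable_rates1.
  - apply/ge0_dnbhsP; exists 1 => // s s0 _ _ y.
    by rewrite normrM mulrC ler_wpM2r//; exact: semigroup_norm_bound.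
apply: cvg_trans; apply: near_eq_cvg; apply/ge0_dnbhsP; exists 1 => // s s0 _ _.
by rewrite (genE hX hk x (bounded_w1 hk (fun y => semigroup_norm_bound y s0))).
Qed.

Lemma semigroup_deriv (t : R) x : 0 <= t -> has_deriv_ge0 (u^~ x) t (gen k (u t) x).
Proof.
move=> t0; apply/has_deriv_ge0P => e e0.
have e20 : 0 < e / 2 by rewrite divr_gt0.
have [d1 d10 H1] := semigroup_increment x e20.
have /cvgrPdist_le/(_ _ e20)/ge0_dnbhsP[d2 d20 H2] := @gen_semigroup_cvg t x t0.
exists (Num.min d1 d2); first by rewrite lt_min d10.
move=> s s0; rewrite lt_min => /andP[sd1 sd2].
have [ts|st] := leP t s.
  have st0 : 0 <= s - t by rewrite subr_ge0.
  have Es : `|s - t| = s - t by rewrite ger0_norm.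
  rewrite Es in sd1 *; have := H1 t (s - t) t0 st0 sd1.
  rewrite (addrC t) subrK mulrC => /le_trans; apply.
  by rewrite ler_wpM2r// ler_pdivrMr// ler_peMr ?(ltW e0)// ler1n.
(* To the left of [t] the expansion starts at [s], with slope [gen k (u s) x]; continuity in time
   replaces it by the slope at [t]. Each error takes half of [e]. *)
have ts0 : 0 <= t - s by rewrite subr_ge0 ltW.
have Es : `|s - t| = t - s by rewrite distrC ger0_norm.
have {}H2 := H2 s s0 (negbT (lt_eqF st)) sd2.
rewrite Es in sd1 *; have := H1 s (t - s) s0 ts0 sd1.
rewrite (addrC s) subrK => H3.
rewrite (_ : u s x - u t x - gen k (u t) x * (s - t) =
  - (u t x - u s x - (t - s) * gen k (u s) x)
  + (t - s) * (gen k (u t) x - gen k (u s) x)); last by ring.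
rewrite (le_trans (ler_normD _ _))// normrN normrM (ger0_norm ts0).
have -> : e * (t - s) = e / 2 * (t - s) + (t - s) * (e / 2) by field.
by apply: lerD => //; apply: ler_wpM2l.
Qed.

End backward_equation.

(** * Derivatives of the entropy *)

Section entropy_derivatives.
Context {R : realType} {d d' : measure_display}.
Context {X : measurableType d} {Om : measurableType d'}.
Hypothesis hX : discrete_countable X.
Variables (k : X -> X -> R) (Pr : X -> probability Om R) (Z : R -> Om -> X).
Hypothesis hk : transition_rates k.
Hypothesis hZ : is_ctmc k Pr Z.
Variable (mu : probability X R).
Hypothesis iw2 : mu.-integrable setT (EFin \o w2 k).
Variables (f : X -> R) (a b : R).
Hypotheses (a_gt0 : 0 < a) (hf : forall x, a <= f x <= b).

Let u t := semigroup Pr Z t f.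
Let C := `|a| + `|b|.
Let D := `|ln a| + `|ln b|.
Let du t x : 0 <= t -> has_deriv_ge0 (u^~ x) t (gen k (u t) x).
Proof. exact: (semigroup_deriv hX hk hZ hf). Qed.

Let C_ge0 : 0 <= C. Proof. by rewrite addr_ge0. Qed.
Let D_ge0 : 0 <= D. Proof. by rewrite addr_ge0. Qed.

Let u_ge t x : 0 <= t -> a <= u t x.
Proof. by move=> t0; case/andP: (semigroup_bounds hX hZ hf x t0). Qed.

Let u_gt0 t x : 0 <= t -> 0 < u t x.
Proof. by move=> t0; apply: lt_le_trans (u_ge x t0). Qed.

Let u_bound t x : 0 <= t -> `|u t x| <= C.
Proof. exact: (semigroup_norm_bound hX hZ hf). Qed.

Let ln_u_bound t x : 0 <= t -> `|ln (u t x)| <= D.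
Proof. by move=> t0; apply: ln_bound (semigroup_bounds hX hZ hf x t0). Qed.

Let gen_u_bound t x : 0 <= t -> `|gen k (u t) x| <= 2 * C * m1 k x.
Proof. by move=> t0; apply: (gen_bound hX hk) => y; exact: u_bound. Qed.

Let gen_u_w1 t x : 0 <= t -> `|gen k (u t) x| <= 2 * C * w1 k x.
Proof.
by move=> t0; apply: m1_bounded_w1 => [|y]; [rewrite mulr_ge0|exact: gen_u_bound].
Qed.

Let gen_gen_u_bound t x : 0 <= t -> `|gen k (gen k (u t)) x| <= 2 * C * w2 k x.
Proof. by move=> t0; apply: (gen_bound_w1 hX hk) => y; exact: gen_u_w1. Qed.

Let m1_w2 x : m1 k x <= w2 k x.
Proof.
by rewrite /w2; have := m1_ge0 hk x; have := m2_ge0 hk x;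
  have := sqr_ge0 (m1 k x); lra.
Qed.

Let sqr_m1_w2 x : m1 k x ^+ 2 <= w2 k x.
Proof. by rewrite /w2; have := m1_ge0 hk x; have := m2_ge0 hk x; lra. Qed.

Let ln1_bound t x : 0 <= t -> `|1 + ln (u t x)| <= 1 + D.
Proof.
by move=> t0; rewrite (le_trans (ler_normD _ _))// normr1 lerD2l; exact: ln_u_bound.
Qed.

(** Differentiation under the sum over [y]: the slope of [u s y] in [s] is at most [2 * C * m1 k y],
    and [|k x y| * m1 k y] is summable in [y] because [M2 k x] is finite. *)
Lemma gen_semigroup_deriv t x : 0 <= t ->
  has_deriv_ge0 (fun s => gen k (u s) x) t (gen k (gen k (u t)) x).
Proof.
move=> t0.
rewrite (genE hX hk x (fun y => gen_u_w1 y t0)).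
have ig := integrable_rates hX hk (F := fun y => 2 * C * m1 k y) (C := 2 * C) x.
have /has_deriv_ge0P H : has_deriv_ge0 (fun s => sumX (fun y => k x y * u s y)) t
    (sumX (fun y => k x y * gen k (u t) y)).
  apply: (has_deriv_ge0_Rintegral (G := fun y => `|k x y * (2 * C * m1 k y)|)) => //.
  - move=> s s0; apply: (integrable_rates hX hk x (C := C)).
    by apply: (bounded_w1 hk) => y; exact: u_bound.
  - exact: discrete_measurable_fun.
  - move=> y; have := has_deriv_ge0M (has_deriv_ge0_cst (k x y) t) (@du t y t0).
    by rewrite mul0r add0r.
  - apply/integrable_norm/ig => y; rewrite ger0_norm ?mulr_ge0 ?(m1_ge0 hk)//.
    by rewrite ler_wpM2l ?mulr_ge0// lerDr.
  - move=> s y s0; rewrite -mulrBr [leLHS]normrM [X in _ <= X * _]normrM -[leRHS]mulrA.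
    apply: ler_wpM2l => //.
    rewrite [X in _ <= X * _]ger0_norm ?mulr_ge0 ?(m1_ge0 hk)//.
    apply: (has_deriv_ge0_lipschitz (fun r => @du r y) _ s0 t0) => r r0.
    exact: gen_u_bound.
apply/has_deriv_ge0P => e e0; have [dl dl0 Hd] := H e e0.
exists dl => // s s0 sd; have := Hd s s0 sd.
by rewrite !(genE hX hk x (bounded_w1 hk (fun y => u_bound y _))).
Qed.

Lemma ln_semigroup_deriv t x : 0 <= t ->
  has_deriv_ge0 (fun s => ln (u s x)) t (gen k (u t) x / u t x).
Proof. by move=> t0; apply: has_deriv_ge0_ln (u_gt0 x t0) (@du t x t0). Qed.

Lemma entropy_deriv t : 0 <= t ->
  has_deriv_ge0 (fun s => entropy mu (u s)) t
    (\int[mu]_x (gen k (u t) x * (1 + ln (u t x)))).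
Proof.
move=> t0.
have dphi r x : 0 <= r ->
    has_deriv_ge0 (fun s => u s x * ln (u s x)) r (gen k (u r) x * (1 + ln (u r x))).
  move=> r0; have := has_deriv_ge0M (@du r x r0) (@ln_semigroup_deriv r x r0).
  rewrite (_ : _ + _ = gen k (u r) x * (1 + ln (u r x)))//.
  by rewrite -/(u r) mulrCA mulfV ?gt_eqF ?u_gt0//; ring.
(* The natural bound is in [m1]; it is weakened to [w2], whose integrability is at hand. *)
have bphi r x : 0 <= r ->
    `|gen k (u r) x * (1 + ln (u r x))| <= 2 * C * (1 + D) * w2 k x.
  move=> r0; rewrite normrM mulrAC ler_pM ?ln1_bound//.
  by rewrite (le_trans (gen_u_bound x r0))// ler_wpM2l ?mulr_ge0.
apply: (has_deriv_ge0_Rintegral (G := fun x => 2 * C * (1 + D) * w2 k x)) => //.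
- move=> s s0.
  have iC : mu.-integrable setT (EFin \o (fun _ : X => C * D)).
    exact: finite_measure_integrable_cst.
  apply: (le_integrable _ _ _ iC) => //; first exact: discrete_measurable_fun.
  move=> x _ /=; rewrite lee_fin (le_trans _ (ler_norm _))// normrM.
  by rewrite ler_pM ?u_bound ?ln_u_bound.
- exact: discrete_measurable_fun.
- by move=> x; exact: dphi.
- exact: integrable_scale.
- move=> s x s0; apply: (has_deriv_ge0_lipschitz (fun r => @dphi r x) _ s0 t0) => r r0.
  exact: bphi.
Qed.

Lemma entropy_deriv2 t : 0 <= t ->
  has_deriv_ge0 (fun s => \int[mu]_x (gen k (u s) x * (1 + ln (u s x)))) t
    (\int[mu]_x (gen k (gen k (u t)) x * (1 + ln (u t x)) +
       gen k (u t) x * (gen k (u t) x / u t x))).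
Proof.
move=> t0.
have dphi r x : 0 <= r -> has_deriv_ge0 (fun s => gen k (u s) x * (1 + ln (u s x))) r
    (gen k (gen k (u r)) x * (1 + ln (u r x)) +
       gen k (u r) x * (gen k (u r) x / u r x)).
  move=> r0; apply: has_deriv_ge0M; first exact: gen_semigroup_deriv.
  have := has_deriv_ge0D (has_deriv_ge0_cst 1 r) (@ln_semigroup_deriv r x r0).
  by rewrite add0r.
(* The first summand bounds the term with [1 + ln u]; the second bounds [(gen k u)^2 / u] by
   [(2 C m1)^2 / a], using [u >= a] and [m1 ^+ 2 <= w2]. *)
pose E := 2 * C * (1 + D) + 2 * C * (2 * C / a).
have bphi r x : 0 <= r -> `|gen k (gen k (u r)) x * (1 + ln (u r x)) +
       gen k (u r) x * (gen k (u r) x / u r x)| <= E * w2 k x.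
  move=> r0; rewrite (le_trans (ler_normD _ _))// /E mulrDl; apply: lerD.
    rewrite normrM mulrAC ler_pM ?ln1_bound//.
    exact: gen_gen_u_bound.
  have K0 : 0 <= 2 * C * (2 * C / a) by rewrite !mulr_ge0// invr_ge0 ltW.
  apply: (le_trans _ (ler_wpM2l K0 (sqr_m1_w2 x))).
  rewrite (_ : _ * m1 k x ^+ 2 = (2 * C * m1 k x) * (2 * C * m1 k x / a)); last by ring.
  rewrite normrM ler_pM ?gen_u_bound// normrM normfV ler_pM ?gen_u_bound//.
  by rewrite lef_pV2 ?posrE ?normr_gt0 ?gt_eqF ?u_gt0// ger0_norm ?u_ge// ltW// u_gt0.
apply: (has_deriv_ge0_Rintegral (G := fun x => E * w2 k x)) => //.
- move=> s s0; apply: (dominated_w2 hX iw2 (C := 2 * C * (1 + D))) => x.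
  rewrite normrM mulrAC ler_pM ?ln1_bound//.
  by rewrite (le_trans (gen_u_bound x s0))// ler_wpM2l ?mulr_ge0.
- exact: discrete_measurable_fun.
- by move=> x; exact: dphi.
- exact: integrable_scale.
- move=> s x s0; apply: (has_deriv_ge0_lipschitz (fun r => @dphi r x) _ s0 t0) => r r0.
  exact: bphi.
Qed.

End entropy_derivatives.

Theorem theorem3p4 (R : realType) (d d' : measure_display)
  (X : measurableType d) (Om : measurableType d')
  (k : X -> X -> R) (Pr : X -> probability Om R) (Z : R -> Om -> X)
  (mu : probability X R) (dens : X -> R)
  (hX : discrete_countable X)
  (hk : transition_rates k)
  (hirr : irreducible_rates k)
  (hZ : is_ctmc k Pr Z)
  (hinv : invariant_measure Pr Z mu)
  (hpi_gt0 : forall x, 0 < dens x)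
  (hpi : forall x, mu [set x] = (dens x)%:E)
  (hdb : forall x y, dens x * k x y = dens y * k y x)
  (hM1 : (fun x => fine (M1 k x)) \in Lfun mu 2%:E)
  (hM2 : (fun x => fine (M2 k x)) \in Lfun mu 1)
  (f : X -> R) (hf : Pstar mu f) :
  let u := fun t => semigroup Pr Z t f in
  let g := fun t x => u t x * Psi2 k (fun y => ln (u t y)) x in
  exists dH : R -> R, forall t : R, 0 <= t ->
    [/\ has_deriv_ge0 (fun s => entropy mu (u s)) t (dH t),
        mu.-integrable [set: X] (EFin \o g t)
      & has_deriv_ge0 dH t (2 * \int[mu]_x g t x)].
Proof.
move=> u g.
have [f_gt0 f_ub inf_gt0 _] := hf.
have f_lb : has_lbound (range f) by exists 0 => _ [x _ <-]; exact: ltW.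
(* The bounds [a] and [b] of the preceding sections are taken to be the infimum and the supremum of
   [f]. *)
have fab x : inf (range f) <= f x <= sup (range f).
  apply/andP; split; first by apply: ge_inf => //; exists x.
  by apply: ub_le_sup => //; exists x.
have im1 := Lfun2_integrable_sqr hM1.
have /Lfun1_integrable im2 := hM2.
(* Since [2 * m1 <= 1 + m1 ^+ 2], the weight [w2] is at most [1 + 2 * m1 ^+ 2 + m2]; the two moment
   assumptions enter here. *)
have iw2 : mu.-integrable setT (EFin \o w2 k).
  have i1 : mu.-integrable setT (EFin \o (fun _ : X => 1 : R)).
    exact: finite_measure_integrable_cst.
  have := integrable_add (integrable_add i1 (integrable_scale 2 im1)) im2.
  apply: le_integrable => //; first exact: discrete_measurable_fun.
  move=> x _ /=; rewrite lee_fin -/(m1 k x) -/(m2 k x).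
  have := m1_ge0 hk x; have := m2_ge0 hk x; have := w2_ge0 hk x => w20 m20 m10.
  have sq : 0 <= m1 k x ^+ 2 by exact: sqr_ge0.
  rewrite !ger0_norm//; last by rewrite !addr_ge0// mulr_ge0.
  by rewrite /w2; have := sqr_ge0 (m1 k x - 1); rewrite sqrrB1; lra.
exists (fun t => \int[mu]_x (gen k (u t) x * (1 + ln (u t x)))) => t t0.
have uab x := semigroup_bounds hX hZ fab x t0.
split.
- exact: (entropy_deriv hX hk hZ iw2 inf_gt0 fab t0).
- exact: (integrable_Psi2 hX hk iw2 inf_gt0 uab).
- rewrite -(integral_Psi2 hX hk hpi hdb iw2 inf_gt0 uab).
  exact: (entropy_deriv2 hX hk hZ iw2 inf_gt0 fab t0).
Qed.
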